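(* Let $(r_i)_{i\ge0}$ and $(k_i)_{i\ge0}$ be sequences of integers such that $r_0\ge0$, $k_i\ge1$, and $r_{i+1}\ge r_i+16k_i+2$ for all $i$, and let $\gamma_i\colon[0,1]\to\mathbb{R}^2$ be the associated curves defined in the context. The curves $\gamma_i$ converge uniformly to a curve $\gamma$ such that $A(\mathcal{D}_k\gamma)=0$ for all $k\ge 0$, but $A(\gamma)$ does not exist. If there is a $c>0$ such that $k_i<c$ for all $i$, then $\gamma$ is $\frac12$-Hölder. For any sequence $(k_i)_i$ of integers with $k_i\ge1$ and any $0<\epsilon<\frac12$, there is a sequence $(r_i)_i$ of integers satisfying $r_0\ge0$ and $r_{i+1}\ge r_i+16k_i+2$ for all $i$ such that $\gamma$ is $(\frac12-\epsilon)$-Hölder.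
   Context: Signed area: for continuous $\gamma=(\gamma_1,\gamma_2)\colon[0,1]\to\mathbb{R}^2$ and a partition $P=\{t_1,\dots,t_k\}$, $0=t_1<\dots<t_k=1$, let $A_P(\gamma)=\frac12\sum_{i=1}^{k-1}(\gamma_1(t_i)\gamma_2(t_{i+1})-\gamma_2(t_i)\gamma_1(t_{i+1}))$ and $\operatorname{mesh}(P)=\max_i(t_{i+1}-t_i)$. $A(\gamma)$ exists and equals $L$ if for any $\epsilon>0$ there is $\delta>0$ such that $\operatorname{mesh}(P)<\delta$ implies $|L-A_P(\gamma)|<\epsilon$. Dyadic approximation: for a curve $f\colon[0,1]\to\mathbb{R}^2$ and $k\ge0$, $\mathcal{D}_kf$ is the function with $\mathcal{D}_kf(j2^{-k})=f(j2^{-k})$ for $0\le j\le 2^k$ and $\mathcal{D}_kf$ affine on each $[j2^{-k},(j+1)2^{-k}]$. Construction of $\gamma_i$: for $i\ge0$ let $a_i=\frac13(1-4^{-i})$ and $b_i=\frac13(1+2\cdot4^{-i})$. Let $\alpha\colon[0,\frac13)\cup(\frac13,1]\to\mathbb{R}$ be the piecewise-linear function with $\alpha(a_i)=\alpha(b_i)=i$ and $\alpha$ affine on $[a_i,a_{i+1}]$ and $[b_{i+1},b_i]$ for all $i$. Let $\beta\colon[0,\infty)\to\mathbb{R}^2$ be the map such that $\beta|_{[0,4]}$ is a unit-speed parameterization of the boundary of the unit square with $\beta(0)=\beta(4)=(0,0)$, and $\beta(t)=(0,0)$ for $t\ge4$. For an integer $k>0$ let $\theta_k\colon[0,1]\to\mathbb{R}^2$,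 $\theta_k(t)=\beta(k^{-1}\alpha(t))=\beta(k^{-1}\min\{4k,\alpha(t)\})$ (so $\theta_k(\frac13)=(0,0)$). Let $\gamma_0$ be the constant curve $0$. Given $\gamma_i$, for $j=0,\dots,2^{r_i}-1$ let $c_{i,j}=j2^{-r_i}$ (also $c_{i,2^{r_i}}=1$) and $m_{i,j}=\frac{c_{i,j}+c_{i,j+1}}2$, and for $t\in[c_{i,j},c_{i,j+1}]$ let $$\gamma_{i+1}(t)=\begin{cases}\gamma_i(c_{i,j})+2^{-\frac{r_i}2}\theta_{k_i}\big((t-c_{i,j})2^{r_i+1}\big)&t\in[c_{i,j},m_{i,j}],\\ \gamma_i\big(c_{i,j}+2(t-m_{i,j})\big)&t\in[m_{i,j},c_{i,j+1}].\end{cases}$$ (Each $\gamma_i$ is affine on every $[j2^{-r_i},(j+1)2^{-r_i}]$.) *)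

(* Defs.v *)
From HB Require Import structures.
From mathcomp Require Import all_boot all_order all_algebra.
From mathcomp Require Import all_classical all_reals all_analysis.
From mathcomp Require Import ring lra.

Set Implicit Arguments.
Unset Strict Implicit.
Unset Printing Implicit Defensive.

Import Order.TTheory GRing.Theory Num.Theory.
Import numFieldNormedType.Exports.

Local Open Scope classical_set_scope.
Local Open Scope ring_scope.

(* A curve [0, 1] -> R^2 is a function R -> R * R; every notion below depends
   only on its restriction to [0, 1]. *)

Section Convergence.
Variable R : realType.
Implicit Types (f : nat -> R -> R * R) (g : R -> R * R).

Definition converges_uniformly01 f g : Prop :=
  {uniform `[0, 1]%classic, f @ \oo --> g}.

Lemma converges_uniformly01P f g : converges_uniformly01 f g <->
  forall eps : R, 0 < eps -> exists N, forall n, (N <= n)%N ->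
    forall t, t \in `[0, 1] ->
      `|(g t).1 - (f n t).1| < eps /\ `|(g t).2 - (f n t).2| < eps.
Proof.
pose B eps := [set xy : (R * R) * (R * R) | ball xy.1 eps xy.2].
split=> [fg eps eps0|fg P /uniform_nbhs[E []]].
  have [|N _ H] := fg [set h | forall t, `[0, 1]%classic t -> B eps (g t, h t)].
    apply/uniform_nbhs; exists (B eps); split => //.
    exact: (entourage_ball _ (PosNum eps0)).
  by exists N => n /H + t t01 => /(_ t t01) [].
rewrite -entourage_from_ballE => -[eps eps0 BE] EP.
have [N H] := fg _ eps0; exists N => // n Nn; apply: EP => t t01.
by apply: BE; have [] := H n Nn t t01.
Qed.

End Convergence.

Section SignedArea.
Variable R : realType.
Implicit Types (g : R -> R * R) (s : seq R) (L : R).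

(* With itv_partition 0 1 s, the partition is P = 0 :: s: strictly increasing,
   with last point 1. *)
Definition area_partition g s : R :=
  2^-1 * \sum_(i < size s)
    let t := nth 0 (0 :: s) i in let t' := nth 0 (0 :: s) i.+1 in
    ((g t).1 * (g t').2 - (g t).2 * (g t').1).

Definition mesh s : R :=
  \big[Num.max/0]_(i < size s) (nth 0 (0 :: s) i.+1 - nth 0 (0 :: s) i).

Definition has_signed_area g L : Prop :=
  forall eps : R, 0 < eps -> exists2 delta : R, 0 < delta &
    forall s, itv_partition 0 1 s -> mesh s < delta ->
      `|L - area_partition g s| < eps.

End SignedArea.

Section Hoelder.
Variable R : realType.

(* The library norm on R * R is the sup norm. *)
Definition enorm2 (p : R * R) : R := Num.sqrt (p.1 ^+ 2 + p.2 ^+ 2).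

Definition hoelder01 (h : R) (g : R -> R * R) : Prop :=
  exists C : R, forall t u : R, t \in `[0, 1] -> u \in `[0, 1] ->
    enorm2 (g t - g u) <= C * `|t - u| `^ h.

End Hoelder.

Section Dyadic.
Variable R : realType.

(* For t in [0, 1], an index j < 2 ^ n such that t belongs to
   [j 2^-n, (j + 1) 2^-n]: the largest one. *)
Definition dyadic_index (n : nat) (t : R) : nat :=
  minn (Num.truncn (t * 2 ^+ n)) (2 ^ n).-1.

Definition dyadic_polygon (n : nat) (g : R -> R * R) (t : R) : R * R :=
  let j := dyadic_index n t in
  let c := j%:R / 2 ^+ n in let c' := j.+1%:R / 2 ^+ n in
  g c + ((t - c) / (c' - c)) *: (g c' - g c).

End Dyadic.

Section Construction.
Variable R : realType.

Definition a_ (i : nat) : R := 3^-1 * (1 - 4 ^- i).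
Definition b_ (i : nat) : R := 3^-1 * (1 + 2 * 4 ^- i).

(* The intervals [a_i, a_(i+1)[ partition [0, 1/3[, and the intervals
   ]b_(i+1), b_i] partition ]1/3, 1]; the value at 1/3 is irrelevant. *)
Definition alpha (t : R) : R :=
  if t < 3^-1 then
    let i := xget 0%N [set n | a_ n <= t < a_ n.+1] in
    i%:R + (t - a_ i) / (a_ i.+1 - a_ i)
  else
    let i := xget 0%N [set n | b_ n.+1 < t <= b_ n] in
    i%:R + (b_ i - t) / (b_ i - b_ i.+1).

(* The boundary of [0, 1]^2 run through once at unit speed, starting from the
   corner (0, 0); ccw chooses between the two possible orientations. *)
Definition beta (ccw : bool) (t : R) : R * R :=
  let p : R * R :=
    if t <= 1 then (t, 0)
    else if t <= 2 then (1, t - 1)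
    else if t <= 3 then (3 - t, 1)
    else if t <= 4 then (0, 4 - t)
    else (0, 0) in
  if ccw then p else (p.2, p.1).

Definition theta (ccw : bool) (k : nat) (t : R) : R * R :=
  if t == 3^-1 then (0, 0) else beta ccw (k%:R^-1 * alpha t).

(* c is c_(i,j) and m is m_(i,j), for j = dyadic_index (r i) t. *)
Fixpoint gamma_ (ccw : bool) (r k : nat -> nat) (i : nat) (t : R) : R * R :=
  if i is i'.+1 then
    let j := dyadic_index (r i') t in
    let c := j%:R / 2 ^+ r i' in let c' := j.+1%:R / 2 ^+ r i' in
    let m := (c + c') / 2 in
    if t <= m then
      gamma_ ccw r k i' c +
        (2 `^ (- ((r i')%:R / 2))) *:
          theta ccw (k i') ((t - c) * 2 ^+ (r i').+1)
    else gamma_ ccw r k i' (c + 2 * (t - m))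
  else (0, 0).

Definition admissible (r k : nat -> nat) : Prop :=
  forall i, (r i + 16 * k i + 2 <= r i.+1)%N.

End Construction.

Section Facts.
Variable R : realType.
Implicit Types (t : R).

Let exp4 n : (4 : R) ^- n.+1 = 4^-1 * 4 ^- n.
Proof. by rewrite exprS invfM. Qed.

Let exp4_gt0 n : 0 < (4 : R) ^- n.
Proof. by rewrite invr_gt0 exprn_gt0. Qed.

Lemma a_0 : a_ R 0 = 0. Proof. by rewrite /a_ expr0 invr1 subrr mulr0. Qed.
Lemma b_0 : b_ R 0 = 1. Proof. by rewrite /b_ expr0 invr1; field. Qed.

Lemma a_lt n : a_ R n < a_ R n.+1.
Proof. rewrite /a_ exp4; have := exp4_gt0 n; lra. Qed.

Lemma b_gt n : b_ R n.+1 < b_ R n.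
Proof. rewrite /b_ exp4; have := exp4_gt0 n; lra. Qed.

Lemma a_lt3 n : a_ R n < 3^-1.
Proof. rewrite /a_; have := exp4_gt0 n; lra. Qed.

Lemma b_gt3 n : 3^-1 < b_ R n.
Proof. rewrite /b_; have := exp4_gt0 n; lra. Qed.

Lemma a_le : {homo a_ R : m n / (m <= n)%N >-> m <= n}.
Proof. by apply: homo_leq => // [x y z|n]; [exact: le_trans|exact/ltW/a_lt]. Qed.

Lemma b_ge : {homo b_ R : m n / (m <= n)%N >-> n <= m}.
Proof.
apply: (@homo_leq _ _ (fun x y => y <= x)) => // [x y z xy yz|n].
  exact: le_trans yz xy.
exact/ltW/b_gt.
Qed.

Let alpha_aE n t : a_ R n <= t < a_ R n.+1 ->
  alpha t = n%:R + (t - a_ R n) / (a_ R n.+1 - a_ R n).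
Proof.
move=> /andP[h1 h2]; rewrite /alpha (lt_trans h2 (a_lt3 _)).
case: xgetP => [m _ /andP[h3 h4]|/(_ n)]; last by rewrite /= h1 h2.
suff -> : m = n by [].
apply/eqP; rewrite eqn_leq; apply/andP; split; rewrite leqNgt; apply/negP.
  by move=> /a_le; rewrite leNgt (le_lt_trans h3 h2).
by move=> /a_le; rewrite leNgt (le_lt_trans h1 h4).
Qed.

Let alpha_bE n t : b_ R n.+1 < t <= b_ R n ->
  alpha t = n%:R + (b_ R n - t) / (b_ R n - b_ R n.+1).
Proof.
move=> /andP[h1 h2]; rewrite /alpha ltNge (ltW (lt_trans (b_gt3 _) h1)) /=.
case: xgetP => [m _ /andP[h3 h4]|/(_ n)]; last by rewrite /= h1 h2.
suff -> : m = n by [].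
apply/eqP; rewrite eqn_leq; apply/andP; split; rewrite leqNgt; apply/negP.
  by move=> /b_ge; rewrite leNgt (lt_le_trans h1 h4).
by move=> /b_ge; rewrite leNgt (lt_le_trans h3 h2).
Qed.

Lemma alpha_a n : alpha (a_ R n) = n%:R.
Proof. by rewrite (@alpha_aE n) ?lexx ?a_lt// subrr mul0r addr0. Qed.

Lemma alpha_b n : alpha (b_ R n) = n%:R.
Proof. by rewrite (@alpha_bE n) ?lexx ?b_gt// subrr mul0r addr0. Qed.

Lemma alpha_affine_a n t : t \in `[a_ R n, a_ R n.+1] ->
  alpha t = n%:R + (t - a_ R n) / (a_ R n.+1 - a_ R n).
Proof.
rewrite in_itv /= => /andP[h1]; rewrite le_eqVlt => /predU1P[->|h2].
  by rewrite alpha_a divff ?natr1// gt_eqF// subr_gt0 a_lt.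
by apply: alpha_aE; rewrite h1.
Qed.

Lemma alpha_affine_b n t : t \in `[b_ R n.+1, b_ R n] ->
  alpha t = n%:R + (b_ R n - t) / (b_ R n - b_ R n.+1).
Proof.
rewrite in_itv /= => /andP[+ h1]; rewrite le_eqVlt => /predU1P[<-|h2].
  by rewrite alpha_b divff ?natr1// gt_eqF// subr_gt0 b_gt.
by apply: alpha_bE; rewrite h2.
Qed.

Let theta0 ccw k : theta ccw k (0 : R) = 0.
Proof.
have := alpha_a 0; rewrite a_0 /theta => ->.
by rewrite mulr0 /beta ler01; case: ccw => /=; case: ifP.
Qed.

Let theta1 ccw k : theta ccw k (1 : R) = 0.
Proof.
have := alpha_b 0; rewrite b_0 /theta => ->.
by rewrite mulr0 /beta ler01; case: ccw => /=; case: ifP.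
Qed.

Let dyadic_indexE n j t : (j < 2 ^ n)%N ->
  j%:R / 2 ^+ n <= t < j.+1%:R / 2 ^+ n -> dyadic_index n t = j.
Proof.
move=> jn; rewrite ler_pdivrMr ?exprn_gt0// ltr_pdivlMr ?exprn_gt0// => h.
rewrite /dyadic_index (truncn_def h); apply/minn_idPl.
by rewrite -ltnS prednK ?expn_gt0.
Qed.

Let dyadic_index_right n j : (j < 2 ^ n)%N ->
  dyadic_index n (j.+1%:R / 2 ^+ n : R) = minn j.+1 (2 ^ n).-1.
Proof.
by move=> jn; rewrite /dyadic_index divfK ?gt_eqF ?exprn_gt0// natrK.
Qed.

Let dyadic_index_right_cases n j : (j < 2 ^ n)%N ->
  dyadic_index n (j.+1%:R / 2 ^+ n : R) = j.+1
  \/ dyadic_index n (j.+1%:R / 2 ^+ n : R) = j.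
Proof.
move=> jn; rewrite dyadic_index_right//.
have [?|?] := ltnP j.+1 (2 ^ n).
  by left; apply/minn_idPl; rewrite -ltnS prednK ?expn_gt0.
have -> : (2 ^ n = j.+1)%N by apply/eqP; rewrite eqn_leq jn andbT.
by right; apply/minn_idPr.
Qed.

Let c_lt n j : j%:R / 2 ^+ n < j.+1%:R / 2 ^+ n :> R.
Proof. by rewrite ltr_pM2r ?invr_gt0 ?exprn_gt0// ltr_nat. Qed.

Lemma dyadic_polygon_affine n (g : R -> R * R) j t :
  let c := j%:R / 2 ^+ n in let c' := j.+1%:R / 2 ^+ n in
  (j < 2 ^ n)%N -> t \in `[c, c'] ->
  dyadic_polygon n g t = g c + ((t - c) / (c' - c)) *: (g c' - g c).
Proof.
move=> c c' jn; rewrite in_itv /= => /andP[h1].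
rewrite le_eqVlt => /predU1P[->|h2]; last first.
  by rewrite /dyadic_polygon (@dyadic_indexE _ j)// h1 h2.
rewrite [RHS](_ : _ = g c'); last first.
  by rewrite divff ?scale1r ?subrKC// gt_eqF// subr_gt0 c_lt.
rewrite /dyadic_polygon; case: (dyadic_index_right_cases jn) => ->.
  by rewrite -/c' subrr mul0r scale0r addr0.
by rewrite divff ?scale1r ?subrKC// gt_eqF// subr_gt0 c_lt.
Qed.

Section Gamma.
Variables (ccw : bool) (r k : nat -> nat).
Local Notation g := (@gamma_ R ccw r k).

Lemma gamma_succ i j t :
  let c := j%:R / 2 ^+ r i in let c' := j.+1%:R / 2 ^+ r i in
  let m := (c + c') / 2 in
  (j < 2 ^ r i)%N ->
  (t \in `[c, m] -> g i.+1 t = g i c +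
     (2 `^ (- ((r i)%:R / 2))) *: theta ccw (k i) ((t - c) * 2 ^+ (r i).+1)) /\
  (t \in `[m, c'] -> g i.+1 t = g i (c + 2 * (t - m))).
Proof.
move=> c c' m jn; have cc' : c < c' := c_lt _ _.
rewrite !in_itv /=; split => /andP[h1 h2].
  rewrite /= (@dyadic_indexE _ j)//; last first.
    by rewrite h1 /= (le_lt_trans h2)// -/c' /m; lra.
  by rewrite -/c -/c' -/m h2.
move: h2; rewrite le_eqVlt => /predU1P[->|h2].
  have -> : c + 2 * (c' - m) = c' by rewrite /m; lra.
  rewrite /=; case: (dyadic_index_right_cases jn) => ->.
    rewrite -/c' ifT.
      by rewrite subrr mul0r theta0 scaler0 addr0.
    by have := c_lt (r i) j.+1; rewrite -/c'; lra.
  rewrite -/c -/c' -/m ifF; first by congr (gamma_ _ _ _ _ _); rewrite /m; lra.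
  by apply/negbTE; rewrite -ltNge /m; lra.
rewrite /= (@dyadic_indexE _ j)//; last first.
  by rewrite h2 andbT (le_trans _ h1)// -/c /m; lra.
rewrite -/c -/c' -/m; case: ifPn => // tm.
have -> : t = m by apply/le_anti; rewrite tm h1.
rewrite subrr mulr0 addr0 (_ : (m - c) * _ = 1) ?theta1 ?scaler0 ?addr0//.
have ? : (2 : R) ^+ r i != 0 by rewrite gt_eqF// exprn_gt0.
by rewrite /m /c /c' exprS -natr1; field.
Qed.

End Gamma.
End Facts.

(* Main.v *)
Require Import Defs.
From mathcomp Require Import all_boot all_order all_algebra.
From mathcomp Require Import all_classical all_reals all_analysis.
From mathcomp Require Import ring lra zify.

Import Order.TTheory GRing.Theory Num.Theory.
Import numFieldNormedType.Exports.

Set Implicit Arguments.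
Unset Strict Implicit.
Unset Printing Implicit Defensive.

Local Open Scope classical_set_scope.
Local Open Scope ring_scope.

(** The area of a curve is additive under concatenation, insensitive to
    reparametrisation, and reversed with the direction of travel, so the loop
    that runs round the square and back has area 0. What matters is at which
    times it is observed.

    Dyadic times. The way out has its vertices at the points [a_ l], the way
    back at the points [b_ l], and at any dyadic level the loop is sampled at
    [a_ 0], ..., [a_ l] and [b_ l], ..., [b_ 0] for some l, at points of the
    segments joining them, and at most at one more time, which is [b_ l.+1].
    Both ways visit the same segments, so the sampled polygon has area 0
    ([chain_theta]). Replacing the affine cells of [gamma_ i] by a small loop
    followed by the old edge therefore creates no dyadic area ([chain_gamma]),
    and the limit has the values of [gamma_ i] on the grid of level [r i]
    ([limit_grid]), hence dyadic area 0 at every level ([chain_limit]). As the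
    curve [dyadic_polygon n gamma] is a polygon, its Riemann sums converge to
    the exact area of its vertices ([has_signed_area_chain]), which is 0.

    Other times. A partition may follow the way out of each loop and jump over
    the way back. A loop in a cell of level [r i] is a square of side
    [2 ^ (- r i / 2)], so it then contributes the area [2 ^ (- r i)], the length
    of the cell; summed over the cells this is 1 up to orientation, although
    the mesh is at most [2 ^ (- r i)] ([chain_limit_loops]). Together with the
    dyadic partitions this forbids any value of the area ([limit_no_area]).

    Regularity. Let [size_ i = 2 ^ (- r i / 2)]. The lower bound on [r i.+1]
    keeps the speed of [gamma_ i] below the inverse of [size_ i]
    ([speed_le]), so one step moves the curve by at most [2 * size_ i]
    ([gamma_step]) and the limit exists. For two times at distance d with
    [size_ i.+1 ^+ 2 < d <= size_ i ^+ 2], the limit is within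
    [4 * size_ i.+1] of [gamma_ i.+1], whose speed is at most
    [2 * 4 ^+ (4 * k i) / size_ i]; both contributions are multiples of the
    square root of d, the second one by a factor that only depends on [k i]
    ([limit_modulus_sqrt]). This factor is bounded when k is, and is absorbed
    by [d `^ eps] when [r i] is large compared with [k i]. *)

(** * Chains of steps and the area they span *)

Section Chains.
Variable R : realType.
Implicit Types (p q v : R * R) (f g : R -> R * R) (E : R -> R -> Prop).
Implicit Types (a b c h t u w K V W : R).

Definition cross p q : R := p.1 * q.2 - p.2 * q.1.

Lemma norm_fst_le p : `|p.1| <= `|p|.
Proof. by rewrite prod_normE le_max lexx. Qed.

Lemma norm_snd_le p : `|p.2| <= `|p|.
Proof. by rewrite prod_normE le_max lexx orbT. Qed.

Lemma scale_coords (a x y : R) : a *: (x, y) = (a * x, a * y).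
Proof. by []. Qed.

Lemma cross_diag p : cross p p = 0.
Proof. by rewrite /cross mulrC subrr. Qed.

Lemma cross_anti p q : cross q p = - cross p q.
Proof. by rewrite /cross; ring. Qed.

Lemma cross_line p v t u :
  cross (p + t *: v) (p + u *: v) = (u - t) * cross p v.
Proof. by case: p v => [x y] [x' y']; rewrite !scale_coords /cross /=; ring. Qed.

Lemma cross_trans_scale p q q' s :
  cross (p + s *: q) (p + s *: q') =
  s * cross p (q' - q) + s ^+ 2 * cross q q'.
Proof.
by case: p q q' => [x y] [x1 y1] [x2 y2]; rewrite !scale_coords /cross /=; ring.
Qed.

Lemma cross_split p q q' :
  cross p q' = cross p q + cross q q' - cross (q - p) (q' - q).
Proof. by case: p q q' => [x y] [x1 y1] [x2 y2]; rewrite /cross /=; ring. Qed.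

Lemma norm_cross_le p q : `|cross p q| <= 2 * `|p| * `|q|.
Proof.
have h1 := norm_fst_le p; have h2 := norm_snd_le p.
have h3 := norm_fst_le q; have h4 := norm_snd_le q.
rewrite (le_trans (ler_normB _ _))// !normrM.
have := ler_pM (normr_ge0 _) (normr_ge0 _) h1 h4.
have := ler_pM (normr_ge0 _) (normr_ge0 _) h2 h3.
lra.
Qed.

(** [chain f E a b V]: some partition of the interval from [a] to [b] has all its
    steps in [E], and the polygon that [f] inscribes along it spans twice the
    signed area [V]. Dyadic grids, partitions of small mesh and subdivisions
    into affine pieces only differ by [E]. *)
Inductive chain f E : R -> R -> R -> Prop :=
| chain_nil a : chain f E a a 0
| chain_cons a b c V :
    E a b -> chain f E b c V -> chain f E a c (cross (f a) (f b) + V).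

Lemma chain1 f E a b : E a b -> chain f E a b (cross (f a) (f b)).
Proof.
by move=> Eab; rewrite -[cross _ _]addr0; apply: chain_cons Eab (chain_nil _ _ _).
Qed.

Lemma chain_cat f E a b c V W :
  chain f E a b V -> chain f E b c W -> chain f E a c (V + W).
Proof.
elim=> [a'|a' b' c' V' Eab _ IH] bcW; first by rewrite add0r.
by rewrite -addrA; apply: chain_cons Eab (IH bcW).
Qed.

(** The refined chain may gain area in each step; a gain proportional to the
    length of the step, with factor [w], is the case that adds up. *)
Lemma chain_refine f g E E' a b V w :
  (forall t u, E t u ->
     chain g E' t u (cross (f t) (f u) + w * (u - t))) ->
  chain f E a b V -> chain g E' a b (V + w * (b - a)).
Proof.
move=> EE'; elim=> {a b V} [a|a b c V Eab _ IH].
  by rewrite subrr mulr0 addr0; exact: chain_nil.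
rewrite (_ : _ + _ = cross (f a) (f b) + w * (b - a) + (V + w * (c - b))).
  exact: chain_cat (EE' _ _ Eab) IH.
ring.
Qed.

Lemma chain_refine0 f g E E' a b V :
  (forall t u, E t u -> chain g E' t u (cross (f t) (f u))) ->
  chain f E a b V -> chain g E' a b V.
Proof.
move=> EE' /(@chain_refine _ g _ E' _ _ _ 0); rewrite mul0r addr0; apply => t u.
by rewrite mul0r addr0; exact: EE'.
Qed.

Lemma chain_mono f E E' a b V :
  (forall t u, E t u -> E' t u) -> chain f E a b V -> chain f E' a b V.
Proof. by move=> EE'; apply: chain_refine0 => t u /EE'; exact: chain1. Qed.

Lemma chain_itv f E a b V : (forall t u, E t u -> t <= u) ->
  chain f E a b V ->
  a <= b /\ chain f (fun t u => [/\ E t u, a <= t & u <= b]) a b V.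
Proof.
move=> Ele; elim=> {a b V} [a|a b c V Eab _ [bc IH]].
  by split=> //; exact: chain_nil.
have ab := Ele _ _ Eab; split; first exact: le_trans bc.
apply: chain_cons => //; apply: chain_mono IH => t u [? bt uc]; split=> //.
exact: le_trans bt.
Qed.

Lemma chain_grid f E h i b V : (forall t u, E t u -> u = t + h) ->
  chain f E (i%:R * h) b V ->
  chain f (fun t u => E t u /\ exists j : nat, t = j%:R * h) (i%:R * h) b V.
Proof.
move=> Eh; move: {-2}(i%:R * h) (erefl (i%:R * h)) => a ea abV.
elim: abV i ea => {a b V} [a|a b c V Eab _ IH] i ea; first exact: chain_nil.
apply: chain_cons; first by split=> //; exists i.
by apply: (IH i.+1); rewrite (Eh _ _ Eab) ea -natr1 mulrDl mul1r.
Qed.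

(** Area is a quadratic form: a homothety of ratio [s] multiplies it by
    [s ^+ 2], and a translation only contributes through the endpoints, hence
    not at all for a closed curve. *)
Lemma chain_image f g E E' phi p (s : R) a b V :
  (forall t u, E t u -> E' (phi t) (phi u) /\
     g (phi t) = p + s *: f t /\ g (phi u) = p + s *: f u) ->
  chain f E a b V ->
  chain g E' (phi a) (phi b) (s * cross p (f b - f a) + s ^+ 2 * V).
Proof.
move=> EE'; elim=> {a b V} [a|a b c V Eab _ IH].
  rewrite subrr (_ : _ + _ = 0); first exact: chain_nil.
  by rewrite /cross /=; ring.
have [E'ab [ga gb]] := EE' _ _ Eab.
have -> : s * cross p (f c - f a) + s ^+ 2 * (cross (f a) (f b) + V) =
    cross (g (phi a)) (g (phi b)) + (s * cross p (f c - f b) + s ^+ 2 * V).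
  by rewrite ga gb cross_trans_scale /cross /=; ring.
exact: chain_cons E'ab IH.
Qed.

(** The bound [K] on the speed is part of the notion, so that a chain of affine
    pieces gives both its area and a Lipschitz constant. *)
Definition affine_on K f a b : Prop :=
  exists p v, `|v| <= K /\ forall t, a <= t <= b -> f t = p + t *: v.

Lemma affine_on_sub K f a b c d : a <= c -> d <= b ->
  affine_on K f a b -> affine_on K f c d.
Proof.
move=> ac db [p [v [vK fE]]]; exists p, v; split=> // t /andP[ct td].
by rewrite fE// (le_trans ac ct) (le_trans td db).
Qed.

Lemma affine_on_cst K f a b p : 0 <= K ->
  (forall t, a <= t <= b -> f t = p) -> affine_on K f a b.
Proof.
move=> K0 fE; exists p, 0; split; first by rewrite normr0.
by move=> t /fE ->; rewrite scaler0 addr0.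
Qed.

Lemma affine_on_interp K f a b v : `|v| <= K ->
  (forall t, a <= t <= b -> f t = f a + (t - a) *: v) -> affine_on K f a b.
Proof.
move=> vK fE; exists (f a - a *: v), v; split=> // t /fE ->.
by rewrite scalerBl -addrA [- _ + _]addrC.
Qed.

Lemma cross_affine K f a b c : a <= b <= c -> affine_on K f a c ->
  cross (f a) (f b) + cross (f b) (f c) = cross (f a) (f c).
Proof.
move=> /andP[ab bc] [p [v [_ fE]]].
rewrite !fE ?lexx ?ab ?bc ?(le_trans ab bc)// !cross_line; ring.
Qed.

Lemma chain_affine K f h n a : 0 <= h -> affine_on K f a (a + n%:R * h) ->
  chain f (fun t u => u = t + h /\ affine_on K f t u) a (a + n%:R * h)
    (cross (f a) (f (a + n%:R * h))).
Proof.
move=> h0; elim: n a => [|n IH] a aff.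
  by rewrite mul0r addr0 cross_diag; exact: chain_nil.
have e : a + n.+1%:R * h = (a + h) + n%:R * h by rewrite -natr1; ring.
have nh0 : 0 <= n%:R * h by rewrite mulr_ge0.
rewrite e in aff *; rewrite -(@cross_affine K f a (a + h))//; last first.
  by rewrite lerDl h0 lerDl nh0.
apply: chain_cons; last by apply: IH; apply: affine_on_sub aff => //; rewrite lerDl.
by split=> //; apply: affine_on_sub aff => //; rewrite lerDl.
Qed.

Definition lip_on K f a b : Prop :=
  forall t u, a <= t -> t <= u -> u <= b -> `|f u - f t| <= K * (u - t).

Lemma affine_on_lip K f a b : affine_on K f a b -> lip_on K f a b.
Proof.
move=> [p [v [vK fE]]] t u at_ tu ub.
rewrite !fE ?at_ ?ub ?(le_trans at_ tu) ?(le_trans tu ub)//.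
rewrite opprD addrACA subrr add0r -scalerBl normrZ ger0_norm ?subr_ge0// mulrC.
by rewrite ler_wpM2r// subr_ge0.
Qed.

Lemma lip_on_trans K f a b c : lip_on K f a b -> lip_on K f b c -> lip_on K f a c.
Proof.
move=> fab fbc t u at_ tu uc.
have [ub|bu] := leP u b; first exact: fab.
have [tb|bt] := leP t b; last by apply: fbc => //; exact: ltW.
have := fab t b at_ tb (lexx b); have := fbc b u (lexx b) (ltW bu) uc.
have := ler_normD (f u - f b) (f b - f t); rewrite addrA subrK; lra.
Qed.

Lemma lip_on_refl K f a : lip_on K f a a.
Proof.
by move=> t u at_ tu ua; rewrite (_ : u = t) ?subrr ?mulr0 ?normr0//; lra.
Qed.

Lemma chain_lip f E K a b V : (forall t u, E t u -> affine_on K f t u) ->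
  chain f E a b V -> lip_on K f a b.
Proof.
move=> Eaff; elim=> {a b V} [a|a b c V Eab _ IH]; first exact: lip_on_refl.
by apply: lip_on_trans IH; apply/affine_on_lip/Eaff.
Qed.

End Chains.
(** * Signed area of polygons *)

Section PolygonArea.
Variable R : realType.
Implicit Types (g : R -> R * R) (E : R -> R -> Prop) (s : seq R).
Implicit Types (a b c h t u K V : R).

Fixpoint cross_sum g a s : R :=
  if s is b :: s' then cross (g a) (g b) + cross_sum g b s' else 0.

Lemma area_partitionE g s : area_partition g s = 2^-1 * cross_sum g 0 s.
Proof.
have sumE b : \sum_(i < size s)
    cross (g (nth 0 (b :: s) i)) (g (nth 0 (b :: s) i.+1)) = cross_sum g b s.
  elim: s b => [|c s IH] b /=; first by rewrite big_ord0.
  by rewrite big_ord_recl /= -IH.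
by rewrite -sumE.
Qed.

Lemma mesh_leP s h : 0 <= h ->
  reflect (mesh s <= h) (path (fun t u => u - t <= h) 0 s).
Proof.
move=> h0; apply: (iffP (pathP 0)) => [H|H i ilt].
  by apply: bigmax_le => // i _; exact: H.
by apply: le_trans H; exact: (le_bigmax _ _ (Ordinal ilt)).
Qed.

Lemma partition_of_chain g E h a b V :
  (forall t u, E t u -> t < u /\ u - t <= h) -> chain g E a b V ->
  exists s, [/\ itv_partition a b s, path (fun t u => u - t <= h) a s
    & cross_sum g a s = V].
Proof.
move=> Eh; elim=> {a b V} [a|a b c V Eab _ [s []]].
  by exists [::]; do 2 split=> //=.
move=> [ps /eqP ls] hs sV; have [ab bah] := Eh _ _ Eab.
exists (b :: s); split; last by rewrite /= sV.
  by split; rewrite /= ?ab ?ls.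
by rewrite /= bah.
Qed.

(** The function [S] is twice the area swept from the origin by [g] since the
    start of the chain; within one affine piece the bound holds with an exact
    equality, and across a vertex the defect is a triangle with two short sides. *)
Lemma swept_area g E K a b V :
  (forall t u, E t u -> t <= u /\ affine_on K g t u) -> chain g E a b V ->
  exists S : R -> R, S b - S a = V /\
    forall t u, a <= t -> t <= u -> u <= b ->
      `|cross (g t) (g u) - (S u - S t)| <= (K * (u - t)) ^+ 2.
Proof.
move=> EK; elim=> {a b V} [a|a b c V Eab ch [S [SV SE]]].
  exists (fun=> 0); rewrite subrr; split=> // t u at_ tu ua.
  have -> : t = a by lra.
  have -> : u = a by lra.
  by rewrite cross_diag !subrr normr0 mulr0 expr0n.
have [ab Kab] := EK _ _ Eab.
have [Elt _] : (forall t u, E t u -> t <= u) /\ True by split=> // t u /EK[].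
have [bc _] := chain_itv Elt ch.
have lab := affine_on_lip Kab.
have lbc : lip_on K g b c by apply: chain_lip ch => t u /EK[].
have [v [w [_ gE]]] := Kab.
pose S' t := if t <= b then cross (g a) (g t)
             else cross (g a) (g b) + (S t - S b).
have S'b t : b <= t -> S' t = cross (g a) (g b) + (S t - S b).
  rewrite /S' => bt; case: ifPn => // tb.
  by have -> : t = b; [lra|rewrite subrr addr0].
have defect_left t u : a <= t -> t <= u -> u <= b ->
    cross (g t) (g u) = S' u - S' t.
  move=> at_ tu ub; rewrite /S' ub (le_trans tu ub).
  rewrite -(@cross_affine _ K g a t u) ?at_ ?tu//; first by ring.
  exact: affine_on_sub Kab.
exists S'; split.
  by rewrite S'b// /S' ab cross_diag subr0 -SV; ring.
move=> t u at_ tu uc.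
have [ub|bu] := leP u b.
  by rewrite defect_left// subrr normr0 sqr_ge0.
have [bt|tb] := leP b t.
  rewrite (S'b t bt) (S'b u (le_trans bt tu)).
  have -> : cross (g a) (g b) + (S u - S b) - (cross (g a) (g b) + (S t - S b))
    = S u - S t by ring.
  exact: SE.
have h1 := defect_left t b at_ (ltW tb) (lexx b).
have h2 := SE b u (lexx b) (ltW bu) uc.
have h3 := lab t b at_ (ltW tb) (lexx b).
have h4 := lbc b u (lexx b) (ltW bu) uc.
have h5 := norm_cross_le (g b - g t) (g u - g b).
have h6 := ler_pM (normr_ge0 _) (normr_ge0 _) h3 h4.
rewrite (cross_split (g t) (g b) (g u)) h1 (S'b b (lexx b)) (S'b u (ltW bu)).
set x := cross _ _ in h2 *; set y := cross _ _ in h5 *.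
rewrite (_ : _ - _ = (x - (S u - S b)) - y); last ring.
have := ler_normB (x - (S u - S b)) y.
have -> : (K * (u - t)) ^+ 2 = (K * (b - t)) ^+ 2 + (K * (u - b)) ^+ 2 +
   2 * (K * (b - t) * (K * (u - b))) by ring.
have := sqr_ge0 (K * (b - t)).
lra.
Qed.

(** Squares of steps sum up to at most the mesh times the length, so a
    quadratic defect vanishes with the mesh, whatever the number of steps. *)
Lemma cross_sum_swept g S K d a b s : 0 <= d ->
  (forall t u, a <= t -> t <= u -> u <= b ->
      `|cross (g t) (g u) - (S u - S t)| <= (K * (u - t)) ^+ 2) ->
  itv_partition a b s -> path (fun t u => u - t <= d) a s ->
  a <= b /\ `|cross_sum g a s - (S b - S a)| <= K ^+ 2 * d * (b - a).
Proof.
move=> d0; elim: s a => [|c s IH] a SE [/= + /eqP lb].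
  by rewrite -lb /= => _ _; rewrite !subrr normr0 mulr0.
move=> /andP[ac cs] /andP[dac dcs].
have [||cb IHs] := IH c _ _ dcs.
- by move=> t u ct; apply: SE; apply: le_trans ct; exact: ltW.
- by split=> //; rewrite lb.
split; first exact: le_trans (ltW ac) cb.
have h1 := SE a c (lexx a) (ltW ac) cb.
have h2 : (K * (c - a)) ^+ 2 <= K ^+ 2 * d * (c - a).
  rewrite exprMn -mulrA ler_wpM2l ?sqr_ge0// expr2 ler_wpM2r// subr_ge0.
  exact: ltW.
rewrite /=; set x := cross _ _ in h1 *; set y := cross_sum _ _ _ in IHs *.
have -> : x + y - (S b - S a) = (x - (S c - S a)) + (y - (S b - S c)) by ring.
have := ler_normD (x - (S c - S a)) (y - (S b - S c)).
lra.
Qed.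

Lemma has_signed_area_chain g E K V :
  (forall t u, E t u -> t <= u /\ affine_on K g t u) -> chain g E 0 1 V ->
  has_signed_area g (2^-1 * V).
Proof.
move=> EK /(swept_area EK)[S [<- SE]] eps eps0.
have K1 : 0 < K ^+ 2 + 1 by have := sqr_ge0 K; lra.
exists (eps / (K ^+ 2 + 1)); first exact: divr_gt0.
set d := eps / _ => s s01 /ltW sd.
have d0 : 0 < d by exact: divr_gt0.
have /(mesh_leP _ (ltW d0)) ps := sd.
have [_] := cross_sum_swept (ltW d0) SE s01 ps.
rewrite area_partitionE -mulrBr normrM distrC gtr0_norm ?invr_gt0// subr0 mulr1.
have -> : eps = (K ^+ 2 + 1) * d by rewrite mulrC divfK// gt_eqF.
have := sqr_ge0 K; have : 0 <= K ^+ 2 * d by rewrite mulr_ge0 ?sqr_ge0 ?ltW.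
rewrite mulrDl mul1r; lra.
Qed.

End PolygonArea.
(** * The loop that runs round the square and back *)

Section Loop.
Variable R : realType.
Implicit Types (t u K : R) (l k n : nat).

Lemma expV_small (m : nat) (x : R) : (1 < m)%N -> 0 < x -> exists n, m%:R ^- n < x.
Proof.
move=> m1 x0; exists (Num.truncn x^-1).+1.
rewrite invf_plt ?posrE ?exprn_gt0 ?ltr0n ?(ltn_trans _ m1)//.
apply: lt_trans (truncnS_gt _) _.
by rewrite -natrX ltr_nat ltn_expl.
Qed.

Lemma pow4 n : (4 : R) ^+ n = 2 ^+ n.*2.
Proof. by rewrite -mul2n exprM; congr (_ ^+ _); ring. Qed.

Lemma a_S l : a_ R l.+1 = a_ R l + 4 ^- l.+1.
Proof.
rewrite /a_ exprS invfM; have : (4 : R) ^- l != 0 by rewrite invr_eq0 expf_neq0.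
by move: (4 ^- l) => x x0; field.
Qed.

Lemma b_S l : b_ R l = b_ R l.+1 + 2 * 4 ^- l.+1.
Proof.
rewrite /b_ exprS invfM; have : (4 : R) ^- l != 0 by rewrite invr_eq0 expf_neq0.
by move: (4 ^- l) => x x0; field.
Qed.

Lemma b_a l : b_ R l = a_ R l + 4 ^- l.
Proof. by rewrite /b_ /a_; field. Qed.

Lemma b_S_a l : b_ R l.+1 = a_ R l + 2 * 4 ^- l.+1.
Proof. by rewrite b_a a_S; ring. Qed.

(** Together with [beta_ge4], this is what makes the loop rest at the origin on a
    whole interval around 1/3. *)
Lemma alpha_ge l t : t != 3^-1 -> a_ R l <= t <= b_ R l -> l%:R <= alpha t.
Proof.
move=> t3 /andP[at_ tb].
have [t_lt|t_gt|te] := ltgtP t 3^-1; last by rewrite te eqxx in t3.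
  have exn : exists n, t < a_ R n.
    have [|n Hn] := @expV_small 4 (1 - 3 * t) isT; first lra.
    by exists n; rewrite /a_; lra.
  case: (ex_minnP exn) => -[|n] tn nmin.
    by have := a_le R (leq0n l); lra.
  have an : a_ R n <= t by rewrite leNgt; apply/negP => /nmin; rewrite ltnn.
  have ln : (l <= n)%N.
    by rewrite leqNgt; apply/negP => /(a_le R); lra.
  rewrite (@alpha_affine_a _ n); last by rewrite in_itv /= an ltW.
  apply: (@le_trans _ _ n%:R); first by rewrite ler_nat.
  by rewrite lerDl divr_ge0 ?subr_ge0// ltW// a_lt.
have exn : exists n, b_ R n < t.
  have [|n Hn] := @expV_small 4 ((3 * t - 1) / 2) isT; first lra.
  by exists n; rewrite /b_; lra.
case: (ex_minnP exn) => -[|n] tn nmin.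
  by have := b_ge R (leq0n l); lra.
have bn : t <= b_ R n by rewrite leNgt; apply/negP => /nmin; rewrite ltnn.
have ln : (l <= n)%N.
  by rewrite leqNgt; apply/negP => /(b_ge R); lra.
rewrite (@alpha_affine_b _ n); last by rewrite in_itv /= bn ltW.
apply: (@le_trans _ _ n%:R); first by rewrite ler_nat.
by rewrite lerDl divr_ge0 ?subr_ge0// ltW// b_gt.
Qed.

Lemma beta_norm_le1 ccw t : 0 <= t -> `|beta ccw t| <= 1.
Proof.
move=> t0; rewrite prod_normE ge_max !ler_norml.
rewrite /beta; case: ccw => /=; do 4?[case: (leP t) => /= ?];
  by apply/andP; split; apply/andP; split; lra.
Qed.

Lemma beta_ge4 ccw t : 4 <= t -> beta ccw t = 0.
Proof.
move=> t4; rewrite /beta; case: ccw => /=; do 4?[case: (leP t) => /= ?];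
  by congr (_, _) => /=; lra.
Qed.

Lemma beta_affine ccw (q : nat) : affine_on (1 : R) (beta ccw) q%:R q.+1%:R.
Proof.
have aff (p v : R * R) : `|v| <= 1 ->
    (forall t : R, q%:R <= t <= q.+1%:R -> beta true t = p + t *: v) ->
    affine_on (1 : R) (beta ccw) q%:R q.+1%:R.
  case: ccw => vK bE; first by exists p, v.
  exists (p.2, p.1), (v.2, v.1).
  rewrite prod_normE maxC -prod_normE; split=> // t /bE; rewrite /beta /= => ->.
  by case: p v {vK bE} => ? ? [? ?].
have norm01 (x y : R) : `|x| <= 1 -> `|y| <= 1 -> `|(x, y)| <= 1.
  by rewrite prod_normE ge_max /= => -> ->.
case: q aff => [|[|[|[|q]]]] aff.
- apply: (aff (0, 0) (1, 0)); first by apply: norm01; rewrite ?normr1 ?normr0.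
  move=> t; rewrite ?mulr0n ?mulr1n scale_coords /beta => /andP[? ?].
  by do 4?[case: (leP t) => /= ?]; congr (_, _) => /=; lra.
- apply: (aff (1, - 1) (0, 1)); first by apply: norm01; rewrite ?normr1 ?normr0.
  move=> t; rewrite ?mulr0n ?mulr1n scale_coords /beta => /andP[? ?].
  by do 4?[case: (leP t) => /= ?]; congr (_, _) => /=; lra.
- apply: (aff (3, 1) (- 1, 0)).
    by apply: norm01; rewrite ?normrN ?normr1 ?normr0.
  move=> t; rewrite ?mulr0n ?mulr1n scale_coords /beta => /andP[? ?].
  by do 4?[case: (leP t) => /= ?]; congr (_, _) => /=; lra.
- apply: (aff (0, 4) (0, - 1)).
    by apply: norm01; rewrite ?normrN ?normr1 ?normr0.
  move=> t; rewrite ?mulr0n ?mulr1n scale_coords /beta => /andP[? ?].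
  by do 4?[case: (leP t) => /= ?]; congr (_, _) => /=; lra.
- apply: affine_on_cst (0 : R * R) _ _ => // t /andP[qt _]; apply: beta_ge4.
  by apply: le_trans qt; rewrite (ler_nat _ 4).
Qed.

Section FixedSpeed.
Variables (ccw : bool) (k : nat).
Hypothesis k_gt0 : (0 < k)%N.
Local Notation th := (@theta R ccw k).

Lemma theta_norm_le1 t : 0 <= t <= 1 -> `|th t| <= 1.
Proof.
move=> t01; rewrite /theta; case: ifPn => [_|t3].
  by rewrite prod_normE /= normr0 maxxx.
by rewrite beta_norm_le1// mulr_ge0// (@alpha_ge 0) ?a_0 ?b_0.
Qed.

Lemma theta_rest t : a_ R (4 * k) <= t <= b_ R (4 * k) -> th t = 0.
Proof.
move=> tab; rewrite /theta; case: ifPn => // t3; apply: beta_ge4.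
by rewrite mulrC ler_pdivlMr ?ltr0n// -natrM alpha_ge.
Qed.

Lemma theta_a l : th (a_ R l) = beta ccw (l%:R / k%:R).
Proof. by rewrite /theta lt_eqF ?a_lt3// alpha_a mulrC. Qed.

Lemma theta_b l : th (b_ R l) = beta ccw (l%:R / k%:R).
Proof. by rewrite /theta gt_eqF ?b_gt3// alpha_b mulrC. Qed.

(** The corners of the square are reached at multiples of [k], so one unit of
    [alpha] never turns a corner. *)
Lemma theta_affine_alpha l c d (x y K : R) :
  (forall t, c <= t <= d ->
     [/\ t != 3^-1, alpha t = x + t * y & l%:R <= alpha t <= l.+1%:R]) ->
  `|y| <= K -> affine_on K th c d.
Proof.
move=> alphaE yK; have k0 : 0 < k%:R :> R by rewrite ltr0n.
have [p [v [v1 betaE]]] := beta_affine ccw (l %/ k).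
exists (p + (k%:R^-1 * x) *: v), ((k%:R^-1 * y) *: v); split.
  rewrite normrZ (le_trans _ yK)// normrM -mulrA -[leRHS]mul1r.
  apply: ler_pM; rewrite ?mulr_ge0//; last by rewrite ler_piMr.
  by rewrite ger0_norm ?invr_ge0 ?ler0n// invf_le1// ler1n.
move=> t /alphaE[t3 aE /andP[la al]].
rewrite /theta (negbTE t3) betaE.
  by rewrite aE -addrA scalerA -scalerDl; congr (_ + _ *: _); ring.
rewrite mulrC ler_pdivlMr// ler_pdivrMr// -!natrM.
rewrite (le_trans _ la) ?ler_nat ?leq_divM//=.
by rewrite (le_trans al)// ler_nat ltn_ceil.
Qed.

Lemma theta_affine_rest l c d : (4 * k <= l)%N -> a_ R l <= c -> d <= b_ R l ->
  affine_on (4 ^+ (4 * k)) th c d.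
Proof.
move=> kl ac db; apply: (@affine_on_cst _ _ _ _ _ 0); first exact: exprn_ge0.
move=> t /andP[ct td]; apply: theta_rest.
by have := a_le R kl; have := b_ge R kl; lra.
Qed.

Lemma theta_affine_a l : affine_on (4 ^+ (4 * k)) th (a_ R l) (a_ R l.+1).
Proof.
have [kl|lk] := leqP (4 * k) l.
  by apply: theta_affine_rest kl _ _ => //; rewrite ltW// (lt_trans (a_lt3 _ _) (b_gt3 _ _)).
have p0 : 0 < (4 : R) ^+ l.+1 by rewrite exprn_gt0.
apply: (@theta_affine_alpha l _ _ (l%:R - a_ R l * 4 ^+ l.+1) (4 ^+ l.+1)).
  move=> t /andP[at_ ta]; split.
  - by rewrite lt_eqF// (le_lt_trans ta)// a_lt3.
  - rewrite (@alpha_affine_a _ l) ?in_itv /= ?at_ ?ta// a_S [_ + _ - _]addrC.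
    by rewrite addrA [- _ + _]addrC subrr add0r invrK; ring.
  - rewrite (@alpha_affine_a _ l) ?in_itv /= ?at_ ?ta// lerDl -natr1 lerD2l.
    have ? := a_lt R l.
    by rewrite divr_ge0 ?ler_pdivrMr ?subr_gt0 ?mul1r ?lerB ?subr_ge0// ltW.
by rewrite ger0_norm ?exprn_ge0// ler_eXn2l// ltr1n.
Qed.

Lemma theta_affine_b l : affine_on (4 ^+ (4 * k)) th (b_ R l.+1) (b_ R l).
Proof.
have [kl|lk] := leqP (4 * k) l.
  by apply: theta_affine_rest kl _ _ => //; rewrite ltW// (lt_trans (a_lt3 _ _) (b_gt3 _ _)).
have p0 : 0 < (4 : R) ^+ l.+1 by rewrite exprn_gt0.
apply: (@theta_affine_alpha l _ _ (l%:R + b_ R l * (4 ^+ l.+1 / 2)) (- (4 ^+ l.+1 / 2))).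
  move=> t /andP[at_ ta]; split.
  - by rewrite gt_eqF// (lt_le_trans _ at_)// b_gt3.
  - rewrite (@alpha_affine_b _ l) ?in_itv /= ?at_ ?ta// {2}b_S [_ + _ - _]addrC.
    rewrite addrA [- _ + _]addrC subrr add0r invfM invrK; lra.
  - rewrite (@alpha_affine_b _ l) ?in_itv /= ?at_ ?ta// lerDl -natr1 lerD2l.
    have ? := b_gt R l.
    by rewrite divr_ge0 ?ler_pdivrMr ?subr_gt0 ?mul1r ?lerB ?subr_ge0// ltW.
rewrite normrN ger0_norm ?divr_ge0 ?exprn_ge0//.
apply: (@le_trans _ _ (4 ^+ l.+1)); first lra.
by rewrite ler_eXn2l// ltr1n.
Qed.

(** From level [8 * k] on, the grid resolves the two points [a_ (4 * k)] and
    [b_ (4 * k)] between which the loop is at rest, and with them all vertices. *)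
Definition theta_step n t u : Prop :=
  u = t + 2 ^- n /\ ((8 * k <= n)%N -> affine_on (4 ^+ (4 * k)) th t u).

Lemma chain_theta_piece n a (d : nat) (x : R) :
  x = d%:R * 2 ^- n -> affine_on (4 ^+ (4 * k)) th a (a + x) ->
  chain th (theta_step n) a (a + x) (cross (th a) (th (a + x))).
Proof.
move=> -> aff; apply: chain_mono (chain_affine _ aff); last by rewrite invr_ge0 exprn_ge0.
by move=> t u [-> ?].
Qed.

(** The induction peels off the pieces from [a_ l] to [a_ l.+1] and from
    [b_ l.+1] to [b_ l], which trace the same segment in opposite directions and
    so cancel. It ends at a level where the interval from [a_ l] to [b_ l] is
    a single step, with equal values at both ends, or is cut once, at [b_ l.+1],
    and then is a segment run forth and back. *)
Lemma chain_theta n l : (l.*2 <= n)%N ->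
  chain th (theta_step n) (a_ R l) (b_ R l) 0.
Proof.
move=> ln; have {ln}[m [e ->]] : exists m (e : bool), n = (l.*2 + e + m.*2)%N.
  exists (n - l.*2)./2, (odd (n - l.*2)).
  by rewrite -addnA odd_double_half subnKC.
elim: m l => [|m IH] l.
  (* [e] says that the interval is two steps long, rather than one. *)
  rewrite addn0; case: e.
    rewrite -(subrr (cross (th (a_ R l)) (th (b_ R l.+1)))) -cross_anti.
    have E : 4 ^- l.+1 * 2 = 2 ^- (l.*2 + 1) :> R.
      by rewrite addn1 pow4 doubleS !exprS; field; rewrite expf_neq0.
    have aff c d : a_ R l <= c -> d <= b_ R l -> (8 * k <= l.*2 + 1)%N ->
        affine_on (4 ^+ (4 * k)) th c d.
      by move=> ac db kl; apply: theta_affine_rest ac db; lia.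
    have h0 : 0 < (2 : R) ^- (l.*2 + 1) by rewrite invr_gt0 exprn_gt0.
    rewrite {2}(_ : th (a_ R l) = th (b_ R l)); last by rewrite theta_a theta_b.
    apply: chain_cat; apply: chain1; split.
    - by rewrite b_S_a -E mulrC.
    - by apply: aff; rewrite ?lexx// ltW// b_gt.
    - by rewrite b_S -E mulrC.
    - by apply: aff; rewrite ?lexx// ltW// (lt_trans (a_lt3 _ _) (b_gt3 _ _)).
  rewrite addn0 -(cross_diag (th (a_ R l))).
  rewrite {2}(_ : th (a_ R l) = th (b_ R l)); last by rewrite theta_a theta_b.
  apply: chain1; split; first by rewrite b_a pow4.
  by move=> kl; apply: (@theta_affine_rest l); rewrite ?lexx//; lia.
have E : 4 ^- l.+1 = (2 ^ (e + m.*2))%:R * 2 ^- (l.*2 + e + m.+1.*2) :> R.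
  rewrite pow4 natrX (_ : l.*2 + _ + _ = l.+1.*2 + (e + m.*2))%N; last lia.
  move: (e + m.*2)%N l.+1.*2 => d c.
  by rewrite exprD invfM mulrCA mulfV ?mulr1// expf_neq0.
have V0 : cross (th (a_ R l)) (th (a_ R l.+1)) +
    (0 + cross (th (b_ R l.+1)) (th (b_ R l))) = 0.
  by rewrite !theta_a !theta_b cross_anti add0r addNr.
rewrite -V0; apply: (chain_cat (b := a_ R l.+1)); last apply: (chain_cat (b := b_ R l.+1)).
- by rewrite a_S; apply: (chain_theta_piece E); rewrite -a_S; exact: theta_affine_a.
- have en : (l.*2 + e + m.+1.*2 = l.+1.*2 + e + m.*2)%N by lia.
  by rewrite en; exact: IH.
- rewrite (b_S l); apply: (@chain_theta_piece _ _ (2 * 2 ^ (e + m.*2))).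
    by rewrite E natrM mulrA.
  by rewrite -b_S; exact: theta_affine_b.
Qed.

End FixedSpeed.
End Loop.
(** * The approximating curves *)

Section AffineComposition.
Variable R : realType.

Lemma affine_on_comp (f g : R -> R * R) (K K' a b c d x y s : R) (p : R * R) :
  affine_on K f a b -> `|s| * `|y| * K <= K' ->
  (forall t, c <= t <= d -> a <= x + y * t <= b /\ g t = p + s *: f (x + y * t)) ->
  affine_on K' g c d.
Proof.
move=> [q [v [vK fE]]] K'E gE.
exists (p + s *: (q + x *: v)), ((s * y) *: v); split.
  by rewrite normrZ normrM (le_trans _ K'E)// ler_wpM2l.
move=> t /gE[/fE -> ->]; rewrite scalerDl addrA [in LHS]scalerDr addrA !scalerA.
by rewrite (_ : t * (s * y) = s * (y * t)); last ring.
Qed.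

Lemma dyadic_cover (n : nat) (t : R) : 0 <= t <= 1 ->
  exists2 j, (j < 2 ^ n)%N & j%:R / 2 ^+ n <= t <= j%:R / 2 ^+ n + 2 ^- n.
Proof.
move=> /andP[t0]; have n0 : 0 < (2 : R) ^+ n by rewrite exprn_gt0.
have SE (j : nat) : j%:R / 2 ^+ n + 2 ^- n = j.+1%:R / 2 ^+ n :> R.
  by rewrite -(natr1 j) mulrDl mul1r.
rewrite le_eqVlt => /predU1P[->|t1].
  exists (2 ^ n).-1; rewrite ?prednK ?expn_gt0//.
  rewrite SE prednK ?expn_gt0// natrX divff ?gt_eqF//.
  by rewrite lexx andbT ler_pdivrMr// mul1r -natrX ler_nat leq_pred.
have tn0 : 0 <= t * 2 ^+ n by rewrite mulr_ge0// ltW.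
have /andP[h1 h2] := truncn_itv tn0; exists (Num.truncn (t * 2 ^+ n)).
  rewrite -(ltr_nat R) (le_lt_trans h1)// natrX -[ltRHS]mul1r.
  by rewrite ltr_pM2r.
by rewrite SE ler_pdivrMr// h1 ler_pdivlMr// ltW.
Qed.

End AffineComposition.

Section Approximations.
Variables (R : realType) (ccw : bool) (r k : nat -> nat).
Hypotheses (k_ge1 : forall i, (1 <= k i)%N) (adm : admissible r k).
Implicit Types (t u : R) (i j n : nat).
Local Notation g := (@gamma_ R ccw r k).
Local Notation th i := (@theta R ccw (k i)).

Definition size_ i : R := 2 `^ (- ((r i)%:R / 2)).

Lemma size_gt0 i : 0 < size_ i.
Proof. exact: powR_gt0. Qed.

Lemma size_ge0 i : 0 <= size_ i.
Proof. exact/ltW/size_gt0. Qed.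

Lemma size_sqr i : size_ i ^+ 2 = 2 ^- r i.
Proof.
rewrite /size_ -powR_mulrn ?powR_ge0// -powRrM mulNr divfK ?pnatr_eq0//.
by rewrite powRN powR_mulrn.
Qed.

(** The growth condition on [r] makes the next loops small even compared with the fast motion along the current ones. *)
Lemma size_step i : 2 * 4 ^+ (4 * k i) * size_ i.+1 <= size_ i.
Proof.
rewrite -(@ler_pXn2r _ 2)// ?nnegrE ?mulr_ge0 ?exprn_ge0 ?size_ge0//.
rewrite !exprMn !size_sqr pow4 -exprM -exprD ler_pdivrMr ?exprn_gt0//.
rewrite mulrC ler_pdivlMr ?exprn_gt0// -exprD ler_eXn2l ?ltr1n//.
by have := adm i; lia.
Qed.

Lemma size_half i : 2 * size_ i.+1 <= size_ i.
Proof.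
apply: le_trans (size_step i); rewrite ler_wpM2r ?size_ge0//.
by rewrite ler_peMr// exprn_ege1// ler1n.
Qed.

Lemma size_small (x : R) : 0 < x -> exists n, forall i, (n <= i)%N -> size_ i < x.
Proof.
move=> x0; have sE n : size_ n <= size_ 0 * 2 ^- n.
  elim: n => [|n IH]; first by rewrite expr0 invr1 mulr1.
  by rewrite exprS invfM; have := size_half n; lra.
have [n nx] := @expV_small R 2 (x / size_ 0) isT (divr_gt0 x0 (size_gt0 0)).
exists n => i ni; apply: le_lt_trans (sE i) _.
rewrite mulrC -ltr_pdivlMr ?size_gt0// (le_lt_trans _ nx)//.
by rewrite lef_pV2 ?posrE ?exprn_gt0// ler_weXn2l// ler1n.
Qed.

(** A bound for the speed of [g i]: a loop of size [size_ i'] is run through at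
    [4 ^+ (4 * k i')] times its size, in time scaled by [2 ^+ (r i').+1], that is
    by twice the inverse square of [size_ i']. *)
Definition speed i : R := if i is i'.+1 then 2 * 4 ^+ (4 * k i') / size_ i' else 0.

Lemma speed_ge0 i : 0 <= speed i.
Proof. by case: i => //= i; rewrite divr_ge0 ?size_ge0// mulr_ge0// exprn_ge0. Qed.

Lemma speed_le i : speed i <= (size_ i)^-1.
Proof.
have s0 := size_gt0; case: i => [|i] /=; first by rewrite invr_ge0 size_ge0.
by rewrite ler_pdivrMr// [leRHS]mulrC ler_pdivlMr//; exact: size_step.
Qed.

Lemma theta_ends i : th i 0 = 0 /\ th i 1 = 0.
Proof.
have b0 : beta ccw (0 : R) = 0 by rewrite /beta ler01; case: ccw.
by rewrite -{1}(a_0 R) -(b_0 R) theta_a theta_b mul0r b0.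
Qed.

Section Step.
Variables (i j : nat).
Hypothesis jlt : (j < 2 ^ r i)%N.
Local Notation c := (j%:R / 2 ^+ r i : R).

Let c_next : j.+1%:R / 2 ^+ r i = c + 2 ^- r i.
Proof. by rewrite -(natr1 j) mulrDl mul1r. Qed.

Let c_mid : (c + (c + 2 ^- r i)) / 2 = c + 2 ^- (r i).+1.
Proof. by rewrite exprS invfM; field; rewrite expf_neq0. Qed.

Lemma gamma_left t : c <= t <= c + 2 ^- (r i).+1 ->
  g i.+1 t = g i c + size_ i *: th i ((t - c) * 2 ^+ (r i).+1).
Proof.
move=> ct; have [+ _] := gamma_succ ccw k t jlt.
by rewrite c_next c_mid in_itv /= ct; apply.
Qed.

Lemma gamma_right t : c + 2 ^- (r i).+1 <= t <= c + 2 ^- r i ->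
  g i.+1 t = g i (c + 2 * (t - (c + 2 ^- (r i).+1))).
Proof.
move=> ct; have [_] := gamma_succ ccw k t jlt.
by rewrite c_next c_mid in_itv /= ct; apply.
Qed.

Let half_le : 2 ^- (r i).+1 <= 2 ^- r i :> R.
Proof. by rewrite lef_pV2 ?posrE ?exprn_gt0// ler_weXn2l// ler1n. Qed.

Lemma gamma_cell_start : g i.+1 c = g i c.
Proof.
rewrite gamma_left ?lexx ?lerDl ?invr_ge0 ?exprn_ge0// subrr mul0r.
by rewrite (theta_ends i).1 scaler0 addr0.
Qed.

Lemma gamma_cell_mid : g i.+1 (c + 2 ^- (r i).+1) = g i c.
Proof. by rewrite gamma_right ?lexx ?lerD2l// subrr mulr0 addr0. Qed.

Lemma gamma_cell_end : g i.+1 (c + 2 ^- r i) = g i (c + 2 ^- r i).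
Proof.
rewrite gamma_right ?lexx ?lerD2l ?half_le//; congr (g i _).
by rewrite exprS invfM; field; rewrite expf_neq0.
Qed.

End Step.

Definition on_grid n t : Prop := exists2 j, (j <= 2 ^ n)%N & t = j%:R * 2 ^- n.

Lemma gamma_succ_grid i t : on_grid (r i) t -> g i.+1 t = g i t.
Proof.
move=> [j jle ->]; have [jlt|] := ltnP j (2 ^ r i); first exact: gamma_cell_start.
move=> jge; have -> : j = (2 ^ r i).-1.+1.
  by rewrite prednK ?expn_gt0//; apply/eqP; rewrite eqn_leq jle.
rewrite -(natr1 _.-1) mulrDl mul1r gamma_cell_end// prednK ?expn_gt0//.
Qed.

Lemma on_grid_le n n' t : (n <= n')%N -> on_grid n t -> on_grid n' t.
Proof.
move=> nn' [j jn ->]; exists (j * 2 ^ (n' - n))%N.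
  by rewrite -{2}(subnKC nn') expnD leq_mul2r jn orbT.
rewrite -{2}(subnKC nn') exprD natrM natrX invfM mulrACA.
by rewrite [_ * (2 ^- _)]mulrC mulrA [X in _ = X * _]mulrC; field;
  rewrite !expf_neq0.
Qed.

Lemma r_le i i' : (i <= i')%N -> (r i <= r i')%N.
Proof.
move=> /subnKC <-; elim: (i' - i)%N => [|n IH]; first by rewrite addn0.
by rewrite addnS (leq_trans IH)//; have := adm (i + n)%N; lia.
Qed.

Lemma r_ge i : (i <= r i)%N.
Proof. by elim: i => // i IH; have := adm i; lia. Qed.

Lemma gamma_grid i i' t : (i <= i')%N -> on_grid (r i) t -> g i' t = g i t.
Proof.
move=> ii' ti; rewrite -(subnKC ii'); elim: (i' - i)%N => [|n IH]; rewrite ?addn0//.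
rewrite addnS gamma_succ_grid ?IH//; apply: on_grid_le ti; apply: r_le; exact: leq_addr.
Qed.

Lemma chain_on_grid f E n (V : R) :
  (forall t u, E t u -> u = t + 2 ^- n) -> chain f E 0 1 V ->
  chain f (fun t u => [/\ E t u, on_grid n u &
     exists2 j, (j < 2 ^ n)%N & t = j%:R / 2 ^+ n]) 0 1 V.
Proof.
have h0 : 0 < (2 : R) ^- n by rewrite invr_gt0 exprn_gt0.
move=> Eh; have := @chain_grid _ f E (2 ^- n) 0 1 V Eh.
rewrite mul0r => /[apply] /chain_itv[]; first by move=> t u [/Eh -> _]; rewrite lerDl ltW.
move=> _; apply: chain_mono => t u [[Etu [j tj]] _ u1]; have uE := Eh _ _ Etu.
have jlt : (j.+1 <= 2 ^ n)%N.
  rewrite -(ler_nat R) natrX -[leRHS]mul1r -ler_pdivrMr ?exprn_gt0//.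
  by rewrite -(natr1 j) mulrDl mul1r -tj -uE.
split=> //; last by exists j.
by exists j.+1; rewrite // uE tj -(natr1 j) mulrDl mul1r.
Qed.

(** Affineness is only true, and only used, from level [r i] on; below it the
    chain records samples of [g i]. *)
Definition gamma_edge i n t u : Prop :=
  u = t + 2 ^- n /\ ((r i <= n)%N -> affine_on (speed i) (g i) t u).

(** A cell of level [r i] first carries a copy of the loop, whose chain has
    value 0, and then the edge of [g i] over that cell at double speed. *)
Lemma chain_gamma_cell i j n : (r i < n)%N -> (j < 2 ^ r i)%N ->
  let c := j%:R / 2 ^+ r i in
  affine_on (speed i) (g i) c (c + 2 ^- r i) ->
  chain (g i.+1) (gamma_edge i.+1 n) c (c + 2 ^- r i)
    (cross (g i c) (g i (c + 2 ^- r i))).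
Proof.
move=> rn jlt c aff; have s0 := size_gt0 i.
have hE : (2 : R) ^- (r i).+1 = 2 ^- r i / 2 by rewrite exprS invfM mulrC.
have h0 : 0 < (2 : R) ^- r i by rewrite invr_gt0 exprn_gt0.
have nE : n = ((r i).+1 + (n - (r i).+1))%N by rewrite subnKC.
set d := (n - (r i).+1)%N in nE.
have dE : (2 : R) ^- n = 2 ^- (r i).+1 * 2 ^- d by rewrite nE exprD invfM.
rewrite -[cross _ _]add0r; apply: (chain_cat (b := c + 2 ^- (r i).+1)).
  have /chain_itv[] := @chain_theta R ccw _ (k_ge1 i) d 0 (leq0n d).
    by move=> t u [-> _]; rewrite lerDl invr_ge0 exprn_ge0.
  move=> _; rewrite a_0 b_0 => /(@chain_image _ _ (g i.+1) _ (gamma_edge i.+1 n)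
    (fun x => c + 2 ^- (r i).+1 * x) (g i c) (size_ i)).
  rewrite (theta_ends i).1 (theta_ends i).2 subrr !mulr0 addr0 mulr1.
  rewrite (_ : _ * cross _ _ = 0); last by rewrite /cross /=; ring.
  rewrite addr0; apply=> x y [[yE xyaff] x0 y1].
  have hd0 : 0 < (2 : R) ^- d by rewrite invr_gt0 exprn_gt0.
  have hr0 : 0 < (2 : R) ^- (r i).+1 by rewrite invr_gt0 exprn_gt0.
  have inE z : x <= z <= y -> g i.+1 (c + 2 ^- (r i).+1 * z) =
      g i c + size_ i *: th i z.
    move=> /andP[xz zy]; rewrite (gamma_left jlt).
      by congr (_ + _ *: th i _); rewrite addrC addKr mulrAC mulVf ?mul1r ?expf_neq0.
    have z0 : 0 <= z := le_trans x0 xz.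
    rewrite lerDl lerD2l (mulr_ge0 (ltW hr0) z0)/= ger_pMr//.
    exact: le_trans y1.
  have xy : x <= y by rewrite yE lerDl ltW.
  split; last by rewrite !inE ?lexx ?xy.
  split; first by rewrite yE dE mulrDr addrA.
  move=> rn'; have {}xyaff := xyaff _.
  apply: (affine_on_comp (p := g i c) (s := size_ i) (y := 2 ^+ (r i).+1)
    (x := - c * 2 ^+ (r i).+1) (xyaff _)).
  - by have := adm i; lia.
  - rewrite !ger0_norm ?exprn_ge0 ?size_ge0//= ler_pdivlMr//.
    rewrite [leLHS](_ : _ = (size_ i ^+ 2 * 2 ^+ r i) * (2 * 4 ^+ (4 * k i))).
      by rewrite size_sqr mulVf ?mul1r// expf_neq0.
    by rewrite exprS; ring.
  - move=> t tE; set z := _ + _.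
    have zE : t = c + 2 ^- (r i).+1 * z.
      by rewrite /z; field; rewrite expf_neq0.
    have xzy : x <= z <= y.
      move: tE => /andP[xt ty]; apply/andP; split.
        by rewrite -(ler_pM2l hr0) -(lerD2l c) -zE.
      by rewrite -(ler_pM2l hr0) -(lerD2l c) -zE.
    by split=> //; rewrite {1}zE inE.
have affr : affine_on (speed i.+1) (g i.+1) (c + 2 ^- (r i).+1) (c + 2 ^- r i).
  apply: (affine_on_comp (p := 0) (s := 1) (y := 2)
    (x := c - 2 * (c + 2 ^- (r i).+1)) aff).
    rewrite normr1 mul1r ger0_norm//=.
    apply: le_trans (_ : 2 * (size_ i)^-1 <= _); first by rewrite ler_wpM2l ?speed_le.
    by rewrite ler_wpM2r ?invr_ge0 ?size_ge0// ler_peMr// exprn_ege1// ler1n.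
  move=> t tE; rewrite (gamma_right jlt)// scale1r add0r; split.
    by move: tE => /andP[]; rewrite hE; lra.
  by rewrite -/c; congr (g i _); ring.
have := @chain_affine _ (speed i.+1) (g i.+1) (2 ^- n) (2 ^ d) (c + 2 ^- (r i).+1).
have -> : c + 2 ^- (r i).+1 + (2 ^ d)%:R * 2 ^- n = c + 2 ^- r i.
  rewrite dE natrX mulrCA mulfV ?expf_neq0// mulr1 hE; lra.
rewrite gamma_cell_mid// gamma_cell_end// => H; apply: chain_mono (H _ affr).
  by move=> t u [-> ?].
by rewrite invr_ge0 exprn_ge0.
Qed.

Lemma chain_gamma i n : chain (g i) (gamma_edge i n) 0 1 0.
Proof.
have h0 m : 0 <= (2 : R) ^- m by rewrite invr_ge0 exprn_ge0.
elim: i n => [|i IH] n.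
  have aff : affine_on (speed 0) (g 0) 0 (0 + (2 ^ n)%:R * 2 ^- n).
    exact: (@affine_on_cst _ _ _ _ _ (0, 0)).
  have := chain_affine (h0 n) aff.
  rewrite cross_diag add0r natrX mulfV ?expf_neq0//.
  by apply: chain_mono => t u [-> ?].
have [nr|rn] := leqP n (r i).
  have /chain_on_grid H := IH n; have {}H := H _ (fun t u => @proj1 _ _).
  apply: chain_refine0 H => t u [[uE _] ug [j jlt tE]].
  rewrite -!(@gamma_succ_grid i).
  - apply: chain1; split=> // /leq_trans/(_ nr).
    by have := adm i; lia.
  - exact: on_grid_le ug.
  - by apply: on_grid_le nr _; exists j; rewrite // ltnW.
have /chain_on_grid H := IH (r i); have {}H := H _ (fun t u => @proj1 _ _).
apply: chain_refine0 H => t u [[uE aff] _ [j jlt tE]].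
rewrite uE tE in aff *.
by apply: chain_gamma_cell => //; apply: aff.
Qed.

Lemma lip_gamma i : lip_on (speed i) (g i) 0 1.
Proof. by apply: chain_lip (chain_gamma i (r i)) => t u [_]; apply. Qed.

(** Both halves of the new cell compare values of [g i] at times at most one cell
    apart, and these differ by at most the speed times the length of a cell. *)
Lemma gamma_step i t : 0 <= t <= 1 -> `|g i.+1 t - g i t| <= 2 * size_ i.
Proof.
move=> t01; have [j jlt /andP[ct tc]] := dyadic_cover (r i) t01.
set c := j%:R / _ in ct tc; have s0 := size_gt0 i.
have h0 : 0 < (2 : R) ^- r i by rewrite invr_gt0 exprn_gt0.
have hE : (2 : R) ^- (r i).+1 = 2 ^- r i / 2 by rewrite exprS invfM mulrC.
have c0 : 0 <= c by rewrite divr_ge0 ?exprn_ge0.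
have lip (x y : R) : 0 <= x -> x <= y -> y <= 1 -> y - x <= 2 ^- r i ->
    `|g i y - g i x| <= size_ i.
  move=> x0 xy y1 yx; apply: le_trans (@lip_gamma i x y x0 xy y1) _.
  have -> : size_ i = (size_ i)^-1 * 2 ^- r i.
    by rewrite -size_sqr expr2 mulrA mulVf ?mul1r ?gt_eqF.
  by apply: ler_pM; rewrite ?speed_ge0 ?speed_le ?subr_ge0.
have [tm|mt] := leP t (c + 2 ^- (r i).+1).
  rewrite (gamma_left jlt) ?ct ?tm// -/c addrAC.
  apply: le_trans (ler_normD _ _) _; rewrite normrZ gtr0_norm//.
  have := lip c t c0 ct _ _; rewrite distrC.
  have : `|th i ((t - c) * 2 ^+ (r i).+1)| <= 1.
    apply: theta_norm_le1; rewrite ?k_ge1// mulr_ge0 ?subr_ge0 ?exprn_ge0//=.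
    by rewrite -ler_pdivlMr ?exprn_gt0// mul1r; lra.
  move: (th i _) => v /(ler_wpM2l (ltW s0)); rewrite mulr1 => h1 h2.
  have {}h2 : `|g i c - g i t| <= size_ i by apply: h2; lra.
  lra.
rewrite (gamma_right jlt) -/c ?(ltW mt)//; set x := c + _.
have xE : x = c + 2 * (t - (c + 2 ^- (r i).+1)) by [].
have := lip x t; rewrite distrC => H.
have {}H : `|g i x - g i t| <= size_ i by apply: H; rewrite ?hE in xE *; lra.
lra.
Qed.

End Approximations.
(** * The limit curve *)

(** The sequence [u n - 4 * s n] increases, [u n + 4 * s n] decreases, and the
    supremum of the former lies between them. *)
Lemma geometric_limit (R : realType) (u s : nat -> R) :
  (forall n, `|u n.+1 - u n| <= 2 * s n) -> (forall n, 2 * s n.+1 <= s n) ->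
  exists l, forall n, `|l - u n| <= 4 * s n.
Proof.
move=> us ss; have s0 n : 0 <= s n.
  by have := us n; have := normr_ge0 (u n.+1 - u n); lra.
pose lo n := u n - 4 * s n; pose hi n := u n + 4 * s n.
have lo_le m n : lo m <= lo (m + n)%N.
  elim: n => [|n IH]; rewrite ?addn0// addnS (le_trans IH)// /lo.
  by have := us (m + n)%N; have := ss (m + n)%N; rewrite ler_norml; lra.
have hi_ge m n : hi (m + n)%N <= hi m.
  elim: n => [|n IH]; rewrite ?addn0// addnS (le_trans _ IH)// /hi.
  by have := us (m + n)%N; have := ss (m + n)%N; rewrite ler_norml; lra.
have lo_hi m n : lo m <= hi n.
  apply: le_trans (lo_le m n) (le_trans _ (hi_ge n m)).
  by rewrite addnC /lo /hi; have := s0 (n + m)%N; lra.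
have ne : range lo !=set0 by exists (lo 0%N), 0%N.
have ub m : ubound (range lo) (hi m) by move=> _ [n _ <-].
exists (sup (range lo)) => n; rewrite ler_distl; apply/andP; split.
  by apply: sup_upper_bound; [split=> //; exists (hi 0%N)|exists n].
exact: ge_sup ne (ub n).
Qed.

Section Limit.
Variables (R : realType) (ccw : bool) (r k : nat -> nat).
Hypotheses (k_ge1 : forall i, (1 <= k i)%N) (adm : admissible r k).
Implicit Types (t u : R) (i j n : nat).
Local Notation g := (@gamma_ R ccw r k).
Local Notation th i := (@theta R ccw (k i)).
Local Notation size_ := (@size_ R r).
Local Notation speed := (@speed R r k).

Definition limit_curve (gamma : R -> R * R) : Prop :=
  forall t, 0 <= t <= 1 -> forall i, `|gamma t - g i t| <= 4 * size_ i.

Lemma limit_curve_exists : exists gamma, limit_curve gamma.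
Proof.
suff /choice[gamma gammaE] : forall t, exists p : R * R,
    0 <= t <= 1 -> forall i, `|p - g i t| <= 4 * size_ i by exists gamma.
move=> t; have [t01|_] := boolP (0 <= t <= 1); last by exists (0, 0).
have lim (f : R * R -> R) : (forall p q, f (p - q) = f p - f q) ->
    (forall p, `|f p| <= `|p|) ->
    exists l, forall i, `|l - f (g i t)| <= 4 * size_ i.
  move=> fB f_le; apply: geometric_limit => i; last exact: size_half adm i.
  by rewrite -fB (le_trans (f_le _))// gamma_step.
have [x xE] := lim fst (fun _ _ => erefl) (@norm_fst_le R).
have [y yE] := lim snd (fun _ _ => erefl) (@norm_snd_le R).
by exists (x, y) => _ i; rewrite prod_normE ge_max xE yE.
Qed.

Variable gamma : R -> R * R.
Hypothesis gammaE : limit_curve gamma.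

Lemma limit_uniform : converges_uniformly01 g gamma.
Proof.
apply/converges_uniformly01P => eps eps0.
have e0 : 0 < eps / 4 by lra.
have [N HN] := size_small adm e0; exists N => n Nn t; rewrite in_itv /= => t01.
have := gammaE t01 n; have := HN n Nn.
have := norm_fst_le (gamma t - g n t); have := norm_snd_le (gamma t - g n t).
by rewrite /=; split; lra.
Qed.

Lemma limit_modulus i t u : 0 <= t -> t <= u -> u <= 1 ->
  `|gamma u - gamma t| <= 8 * size_ i + speed i * (u - t).
Proof.
move=> t0 tu u1.
have ht : `|gamma t - g i t| <= 4 * size_ i by apply: gammaE; rewrite t0 (le_trans tu).
have hu : `|gamma u - g i u| <= 4 * size_ i by apply: gammaE; rewrite u1 (le_trans t0).
have hl := @lip_gamma _ ccw _ _ k_ge1 adm i t u t0 tu u1.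
have := ler_distD (g i u) (gamma u) (gamma t).
have := ler_distD (g i t) (g i u) (gamma t).
rewrite [`|g i t - gamma t|]distrC; lra.
Qed.

Lemma limit_continuous : {within `[0, 1]%classic, continuous gamma}.
Proof.
apply/subspace_continuousP => x; rewrite /= in_itv /= => /andP[x0 x1].
apply/cvgrPdist_lt => eps eps0.
have e0 : 0 < eps / 16 by lra.
have [N HN] := size_small adm e0.
have K0 := speed_ge0 R r k N.
have d0 : 0 < eps / (2 * (speed N + 1)) by rewrite divr_gt0//; lra.
rewrite near_withinE; near=> t; rewrite /= in_itv /= => /andP[t0 t1].
have xt : `|x - t| < eps / (2 * (speed N + 1)).
  by near: t; apply: cvgr_dist_lt.
have {}xt : speed N * `|x - t| < eps / 2.
  apply: (@le_lt_trans _ _ ((speed N + 1) * `|x - t|)); first by rewrite ler_wpM2r//; lra.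
  rewrite -ltr_pdivlMl; last lra.
  by rewrite [ltRHS](_ : _ = eps / (2 * (speed N + 1)))//; field; rewrite gt_eqF//; lra.
have hN := HN N (leqnn N).
have [tx|xt'] := leP t x.
  have := @limit_modulus N t x t0 tx x1; rewrite ger0_norm ?subr_ge0// in xt; lra.
have := @limit_modulus N x t x0 (ltW xt') t1; rewrite distrC.
rewrite distrC gtr0_norm ?subr_gt0// in xt; lra.
Unshelve. all: by end_near. Qed.

Lemma on_grid_itv n t : on_grid n t -> 0 <= t <= 1.
Proof.
move=> [j jn ->]; rewrite mulr_ge0 ?invr_ge0 ?exprn_ge0//=.
by rewrite ler_pdivrMr ?exprn_gt0// mul1r -natrX ler_nat.
Qed.

Lemma on_gridI n j t : t = j%:R * 2 ^- n -> t <= 1 -> on_grid n t.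
Proof.
move=> -> j1; exists j => //; move: j1.
by rewrite ler_pdivrMr ?exprn_gt0// mul1r -natrX ler_nat.
Qed.

(** The construction never moves a point of a grid it has already used, so
    the distance to the limit there is below every [4 * size_ i]. *)
Lemma limit_grid i t : on_grid (r i) t -> gamma t = g i t.
Proof.
move=> ti; apply/eqP; rewrite -subr_eq0 -normr_eq0; apply/eqP/le_anti.
rewrite normr_ge0 andbT leNgt; apply/negP => pos.
have e0 : 0 < `|gamma t - g i t| / 4 by lra.
have [N HN] := size_small adm e0.
have := gammaE (on_grid_itv ti) (maxn N i).
rewrite (gamma_grid ccw adm (leq_maxr N i) ti).
by have := HN _ (leq_maxl N i); lra.
Qed.

Lemma chain_limit n : chain gamma (fun t u => u = t + 2 ^- n) 0 1 0.
Proof.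
have := chain_gamma R ccw k_ge1 adm n n => /chain_on_grid H.
have {}H := H _ (fun t u => @proj1 _ _).
apply: chain_refine0 H => t u [[uE _] ug [j jlt tE]].
rewrite -!(@limit_grid n).
- exact: chain1.
- by apply: on_grid_le ug; exact: r_ge adm n.
- apply: on_grid_le (r_ge adm n) _; exists j => //; exact: ltnW.
Qed.

Lemma limit_dyadic_area n : has_signed_area (dyadic_polygon n gamma) 0.
Proof.
have h0 : 0 < (2 : R) ^- n by rewrite invr_gt0 exprn_gt0.
have Kch : chain (dyadic_polygon n gamma) (fun t u => t <= u /\
    affine_on (2 ^+ n * (8 * size_ 0%N)) (dyadic_polygon n gamma) t u) 0 1 0.
  have /chain_on_grid H := chain_limit n; have {}H := H _ (fun t u => id).
  apply: chain_refine0 H => t u [uE ug [j jlt tE]].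
  have uE' : u = j.+1%:R / 2 ^+ n by rewrite uE tE -(natr1 j) mulrDl mul1r.
  have ut : u - t = 2 ^- n by rewrite uE addrC addKr.
  have tu : t <= u by rewrite -subr_ge0 ut ltW.
  have polyE x : t <= x <= u -> dyadic_polygon n gamma x =
      gamma t + ((x - t) / (u - t)) *: (gamma u - gamma t).
    move=> xtu; have := @dyadic_polygon_affine R n gamma j x jlt.
    by rewrite -tE -uE' in_itv /=; apply.
  have pt : dyadic_polygon n gamma t = gamma t.
    by rewrite polyE ?lexx// subrr mul0r scale0r addr0.
  have pu : dyadic_polygon n gamma u = gamma u.
    rewrite polyE ?lexx ?tu// divff; last by rewrite ut gt_eqF.
    by rewrite scale1r addrC subrK.
  rewrite -pt -pu; apply: chain1; split=> //.
  apply: (@affine_on_interp _ _ _ _ _ (2 ^+ n *: (gamma u - gamma t))).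
    rewrite normrZ ger0_norm ?exprn_ge0// ler_wpM2l ?exprn_ge0//.
    have := @limit_modulus 0 t u; rewrite /= mul0r addr0; apply=> //.
      by rewrite tE divr_ge0 ?exprn_ge0.
    by have /andP[] := on_grid_itv ug.
  by move=> x xtu; rewrite polyE// pt ut invrK scalerA.
have := has_signed_area_chain (fun _ _ => id) Kch.
by rewrite mulr0.
Qed.

Definition turn : R := if ccw then 1 else - 1.

Lemma beta_corners : [/\ beta ccw 1 = if ccw then (1, 0) else (0, 1) :> R * R,
  beta ccw 2 = (1, 1) :> R * R &
  beta ccw 3 = if ccw then (0, 1) else (1, 0) :> R * R].
Proof.
rewrite /beta; case: ccw => /=; split; do 4?[case: leP => /= ?];
  by congr (_, _); lra.
Qed.

Lemma a_on_grid l : on_grid l.*2 (a_ R l).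
Proof.
have [j jE] : exists j, a_ R l = j%:R * 2 ^- l.*2.
  elim: l => [|l [j IH]]; first by exists 0%N; rewrite a_0 mul0r.
  exists (4 * j + 1)%N; rewrite a_S IH pow4 doubleS !exprS natrD natrM.
  by field; rewrite expf_neq0.
by apply: (on_gridI jE); have := a_lt3 R l; lra.
Qed.

(** The corners are taken on the way out; the last step goes from the fourth
    corner to the end of the loop and skips the way back, so that a full turn
    round the unit square is seen. *)
Lemma chain_theta_corners i : chain (th i)
  (fun t u => [/\ t < u, on_grid (6 * k i) t & on_grid (6 * k i) u])
  0 1 (turn * 2).
Proof.
have k0 := k_ge1 i.
have grid q : (q <= 3)%N -> on_grid (6 * k i) (a_ R (q * k i)).
  by move=> q3; apply: on_grid_le (a_on_grid _); nia.
have thq q : th i (a_ R (q * k i)) = beta ccw q%:R.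
  by rewrite theta_a natrM mulfK// pnatr_eq0 -lt0n.
have mono q : a_ R (q * k i) < a_ R (q.+1 * k i).
  apply: lt_le_trans (a_lt R _) _; apply: a_le; nia.
have grid1 : on_grid (6 * k i) (1 : R).
  by exists (2 ^ (6 * k i))%N => //; rewrite natrX mulfV// expf_neq0.
have [b1 b2 b3] := beta_corners; have [th0 th1] := theta_ends R ccw k i.
have V : turn * 2 = cross (th i 0) (th i (a_ R (1 * k i))) +
  (cross (th i (a_ R (1 * k i))) (th i (a_ R (2 * k i))) +
  (cross (th i (a_ R (2 * k i))) (th i (a_ R (3 * k i))) +
  (cross (th i (a_ R (3 * k i))) (th i 1) + 0))).
  rewrite !thq th0 th1 b1 b2 b3 /turn /cross.
  by case: ccw => /=; ring.
have m0 := mono 0%N; rewrite mul0n a_0 in m0.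
have g0 := grid 0%N isT; rewrite mul0n a_0 in g0.
rewrite V; do 4?apply: chain_cons; try exact: chain_nil; split=> //;
  try exact: grid; try exact: mono.
by have := a_lt3 R (3 * k i); lra.
Qed.

(** The grid of level [r i.+1] is fine enough to contain the corners of the loops
    added at step i, so later steps do not move them. *)
Lemma limit_loop i j x : (j < 2 ^ r i)%N -> on_grid (6 * k i) x ->
  let c := j%:R / 2 ^+ r i in
  gamma (c + 2 ^- (r i).+1 * x) = g i c + size_ i *: th i x.
Proof.
move=> jlt xg c; have /andP[x0 x1] := on_grid_itv xg.
have h0 n : 0 < (2 : R) ^- n by rewrite invr_gt0 exprn_gt0.
have hE : (2 : R) ^- (r i).+1 = 2 ^- r i / 2 by rewrite exprS invfM mulrC.
have xh : 2 ^- (r i).+1 * x <= 2 ^- (r i).+1 by rewrite ger_pMr.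
have xh0 : 0 <= 2 ^- (r i).+1 * x by rewrite mulr_ge0// ltW.
have c1 : c + 2 ^- r i <= 1.
  rewrite -[X in _ + X]mul1r -mulrDl natr1 ler_pdivrMr ?exprn_gt0// mul1r.
  by rewrite -natrX ler_nat.
rewrite (@limit_grid i.+1).
  rewrite (gamma_left ccw k jlt); last by rewrite lerDl xh0 lerD2l xh.
  by congr (_ + _ *: th i _); rewrite addrC addKr mulrAC mulVf ?mul1r ?expf_neq0//.
have [m _ xE] := xg.
apply: (@on_grid_le _ ((r i).+1 + 6 * k i)%N); first by have := adm i; lia.
apply: (@on_gridI _ (j * 2 ^ (6 * k i).+1 + m)).
  rewrite xE /c natrD natrM natrX; move: (r i) (6 * k i)%N => e d.
  by rewrite exprD !exprS; field; rewrite !expf_neq0.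
by have := h0 (r i); lra.
Qed.

(** Every cell of level [r i] contributes a square of side [size_ i], whose area
    is the length of the cell; so the contributions add up to a full turn. *)
Lemma chain_limit_loops i :
  chain gamma (fun t u => t < u /\ u - t <= 2 ^- r i) 0 1 (turn * 2).
Proof.
have h0 n : 0 < (2 : R) ^- n by rewrite invr_gt0 exprn_gt0.
have hE : (2 : R) ^- (r i).+1 = 2 ^- r i / 2 by rewrite exprS invfM mulrC.
have /chain_on_grid H := chain_gamma R ccw k_ge1 adm i (r i).
have {}H := H _ (fun t u => @proj1 _ _).
have -> : turn * 2 = 0 + turn * 2 * (1 - 0) by ring.
apply: chain_refine H => t u [[uE _] ug [j jlt tE]].
have [th0 th1] := theta_ends R ccw k i.
rewrite addrC; apply: (chain_cat (b := t + 2 ^- (r i).+1)).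
  have /chain_itv[] := chain_theta_corners i; first by move=> x y [/ltW].
  move=> _ /(@chain_image _ _ gamma _ (fun t u => t < u /\ u - t <= 2 ^- r i)
    (fun x => t + 2 ^- (r i).+1 * x) (g i t) (size_ i)).
  rewrite th0 th1 subrr mulr0 addr0 mulr1 size_sqr.
  rewrite (_ : _ * cross _ _ = 0); last by rewrite /cross /=; ring.
  have ut : u - t = 2 ^- r i by rewrite uE addrC addKr.
  rewrite add0r ut [_ * (turn * 2)]mulrC; apply=> x y [[xy xg yg] x0 y1].
  rewrite tE !limit_loop//; split=> //; split; first by rewrite ltrD2l ltr_pM2l.
  rewrite opprD addrACA subrr add0r -mulrBr.
  apply: (@le_trans _ _ (2 ^- (r i).+1)).
    by rewrite ger_pMr//; lra.
  by rewrite hE; have := h0 (r i); lra.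
have gm : gamma (t + 2 ^- (r i).+1) = g i t.
  rewrite tE -[X in _ + X]mulr1 limit_loop//.
    by rewrite th1 scaler0 addr0.
  by exists (2 ^ (6 * k i))%N => //; rewrite natrX mulfV// expf_neq0.
rewrite -gm -(limit_grid ug); apply: chain1.
by rewrite uE hE; have := h0 (r i); split; lra.
Qed.

(** At the same mesh, the dyadic partition and the one that follows the loops
    span areas at distance 1, and no number is within less than 1/2 of both. *)
Lemma limit_no_area : ~ exists L, has_signed_area gamma L.
Proof.
move=> [L areaL]; have [|d d0 H] := areaL 2^-1; first by rewrite invr_gt0.
have [n nd] := @expV_small R 2 d isT d0.
have h0 : 0 < (2 : R) ^- r n by rewrite invr_gt0 exprn_gt0.
have small : (2 : R) ^- r n < d.
  apply: le_lt_trans nd; rewrite lef_pV2 ?posrE ?exprn_gt0//.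
  by rewrite ler_weXn2l ?ler1n// (r_ge adm).
have close V : chain gamma (fun t u => t < u /\ u - t <= 2 ^- r n) 0 1 V ->
    `|L - 2^-1 * V| < 2^-1.
  move=> /(partition_of_chain (fun _ _ => id))[s [s01 ps <-]].
  rewrite -area_partitionE; apply: H => //.
  by apply: le_lt_trans small; apply/mesh_leP => //; exact: ltW.
have := close _ (chain_limit_loops n).
have : `|L - 2^-1 * 0| < 2^-1.
  apply: close; apply: chain_mono (chain_limit (r n)) => t u ->.
  by rewrite ltrDl h0 addrC addKr.
by rewrite mulr0 subr0 !ltr_norml /turn; case: ccw; lra.
Qed.

(** Between two scales, [sqrt d] dominates the size of all later loops, and
    within the loops of the current scale it is their speed that matters. *)
Lemma limit_modulus_sqrt t u : 0 <= t -> t < u -> u <= 1 ->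
  `|gamma u - gamma t| <= 8 * Num.sqrt (u - t) \/
  exists2 i, u - t <= 2 ^- r i &
    `|gamma u - gamma t| <= 10 * 4 ^+ (4 * k i) * Num.sqrt (u - t).
Proof.
move=> t0 tu u1; set d := u - t; have d0 : 0 < d by rewrite subr_gt0.
set q := Num.sqrt d; have q0 : 0 < q by rewrite sqrtr_gt0.
have qE : q ^+ 2 = d by rewrite sqr_sqrtr// ltW.
have exn : exists n, 2 ^- r n < d.
  have [n nd] := @expV_small R 2 d isT d0; exists n; apply: le_lt_trans nd.
  by rewrite lef_pV2 ?posrE ?exprn_gt0// ler_weXn2l ?ler1n// (r_ge adm).
have s0 := @size_ge0 R r.
have sq n : 2 ^- r n < d -> size_ n <= q.
  by rewrite -size_sqr -qE ltr_pXn2r ?nnegrE ?s0 ?(ltW q0)//; exact: ltW.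
case: (ex_minnP exn) => -[|i] /sq sqn nmin.
  left; have := limit_modulus 0 t0 (ltW tu) u1; rewrite /= mul0r addr0; lra.
right; exists i; first by rewrite leNgt; apply/negP => /nmin; rewrite ltnn.
have di : d <= size_ i ^+ 2.
  by rewrite size_sqr leNgt; apply/negP => /nmin; rewrite ltnn.
have qi : q <= size_ i.
  by move: di; rewrite -qE ler_pXn2r ?nnegrE ?s0 ?(ltW q0).
have := limit_modulus i.+1 t0 (ltW tu) u1; rewrite -/d /= -qE.
have p1 : 1 <= (4 : R) ^+ (4 * k i) by rewrite exprn_ege1// ler1n.
set p := 4 ^+ _ in p1 *.
have h1 : 2 * p / size_ i * q ^+ 2 <= 2 * p * q.
  rewrite expr2 mulrA ler_wpM2r ?(ltW q0)// -mulrA ger_pMr; last lra.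
  by rewrite mulrC ler_pdivrMr ?mul1r// size_gt0.
have h2 : 8 * q <= 8 * p * q by rewrite ler_wpM2r ?(ltW q0)//; lra.
have -> : 10 * p * q = 8 * p * q + 2 * p * q by ring.
lra.
Qed.

End Limit.

Lemma hoelder01_of_ordered (R : realType) (h C : R) (f : R -> R * R) : 0 <= C ->
  (forall t u, 0 <= t -> t < u -> u <= 1 -> `|f u - f t| <= C * (u - t) `^ h) ->
  hoelder01 h f.
Proof.
move=> C0 fC; exists (2 * C) => t u; rewrite !in_itv /= => /andP[t0 t1] /andP[u0 u1].
have norm2 (p : R * R) : enorm2 p <= 2 * `|p|.
  have p0 : 0 <= 2 * `|p| by rewrite mulr_ge0.
  rewrite /enorm2 -(ger0_norm p0) -sqrtr_sqr ler_wsqrtr//.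
  have h1 : p.1 ^+ 2 <= `|p| ^+ 2.
    by rewrite -real_normK ?num_real// ler_pXn2r ?nnegrE// prod_normE le_max lexx.
  have h2 : p.2 ^+ 2 <= `|p| ^+ 2.
    by rewrite -[leLHS]real_normK ?num_real// ler_pXn2r ?nnegrE// prod_normE le_max lexx orbT.
  by rewrite exprMn; have := sqr_ge0 (`|p| : R); lra.
apply: le_trans (norm2 _) _; rewrite -mulrA ler_wpM2l//.
have [tu|ut|->] := ltgtP t u.
- by rewrite distrC [`|t - u|]distrC gtr0_norm ?subr_gt0// fC.
- by rewrite [`|t - u|]gtr0_norm ?subr_gt0// fC.
- by rewrite subrr normr0 mulr_ge0// powR_ge0.
Qed.

Theorem lemmaB4 (R : realType) (ccw : bool) :
  (forall r k : nat -> nat,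
     (forall i, (1 <= k i)%N) -> admissible r k ->
     exists gamma : R -> R * R,
     [/\ converges_uniformly01 (@gamma_ R ccw r k) gamma /\
         {within `[0, 1]%classic, continuous gamma},
         forall n : nat, has_signed_area (dyadic_polygon n gamma) 0,
         ~ (exists L : R, has_signed_area gamma L)
       & (exists2 c : R, 0 < c & forall i, (k i)%:R < c) ->
         hoelder01 2^-1 gamma]) /\
  (forall (k : nat -> nat) (eps : R),
     (forall i, (1 <= k i)%N) -> 0 < eps < 2^-1 ->
     exists2 r : nat -> nat, admissible r k &
       exists2 gamma : R -> R * R,
         converges_uniformly01 (@gamma_ R ccw r k) gamma &
         hoelder01 (2^-1 - eps) gamma).
Proof.
split=> [r k k1 adm|k eps k1 /andP[eps0 eps1]].
  have [gamma gammaE] := limit_curve_exists R ccw k1 adm.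
  exists gamma; split.
  - split; first exact: (@limit_uniform _ _ _ _ adm _ gammaE).
    exact: (@limit_continuous _ _ _ _ k1 adm _ gammaE).
  - move=> n; exact: (@limit_dyadic_area _ _ _ _ k1 adm _ gammaE n).
  - exact: (@limit_no_area _ _ _ _ k1 adm _ gammaE).
  move=> [c c0 kc]; set N := (Num.truncn c).+1.
  have kN i : 4 ^+ (4 * k i) <= 4 ^+ (4 * N) :> R.
    rewrite ler_weXn2l ?ler1n// leq_mul2l /= ltnW//.
    by rewrite -(ltr_nat R) (lt_trans (kc i)) ?truncnS_gt.
  have p1 : 1 <= (4 : R) ^+ (4 * N) by rewrite exprn_ege1// ler1n.
  apply: (@hoelder01_of_ordered _ _ (10 * 4 ^+ (4 * N))) => [|t u t0 tu u1].
    by rewrite mulr_ge0// exprn_ge0.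
  rewrite powR12_sqrt ?subr_ge0 ?(ltW tu)//.
  have [|[i _]] := limit_modulus_sqrt k1 adm gammaE t0 tu u1 => /le_trans; apply.
    by rewrite ler_wpM2r ?sqrtr_ge0//; lra.
  by rewrite ler_wpM2r ?sqrtr_ge0// ler_wpM2l.
(* With r i >= N k i, the factor 4 ^+ (4 * k i) of the modulus is absorbed by
   d `^ eps on the scales d <= 2 ^- r i. *)
set N := (Num.truncn (8 / eps)).+1.
have N8 : 8 <= N%:R * eps by rewrite -ler_pdivrMr// ltW// truncnS_gt.
pose r := fix r i := if i is i'.+1 then (r i' + 16 * k i' + 2 + N * k i)%N
                     else (N * k 0)%N.
have rN i : (N * k i <= r i)%N by case: i => //= i; lia.
have adm : admissible r k by move=> i /=; lia.
exists r => //; have [gamma gammaE] := limit_curve_exists R ccw k1 adm.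
exists gamma; first exact: (@limit_uniform _ _ _ _ adm _ gammaE).
apply: (@hoelder01_of_ordered _ _ 10) => // t u t0 tu u1.
set d := u - t; have d0 : 0 < d by rewrite subr_gt0.
have d1 : d <= 1 by rewrite /d; lra.
have sqrtE : Num.sqrt d = d `^ eps * d `^ (2^-1 - eps).
  by rewrite -powR12_sqrt ?ltW// -powRD ?gt_eqF ?implybT// addrC subrK.
have [|[i di]] := limit_modulus_sqrt k1 adm gammaE t0 tu u1.
  rewrite -/d sqrtE => /le_trans; apply; rewrite mulrA ler_wpM2r ?powR_ge0//.
  have : d `^ eps <= 1 `^ eps by rewrite ge0_ler_powR ?nnegrE ?(ltW d0) ?(ltW eps0).
  by rewrite powR1; lra.
rewrite -/d sqrtE => /le_trans; apply; rewrite mulrA ler_wpM2r ?powR_ge0//.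
rewrite -mulrA ger_pMr// pow4.
have : d `^ eps <= (2 ^- r i) `^ eps.
  by rewrite ge0_ler_powR ?nnegrE ?invr_ge0 ?exprn_ge0 ?(ltW d0) ?(ltW eps0).
move=> /(ler_wpM2l (exprn_ge0 (4 * k i).*2 (ler0n R 2))) /le_trans; apply.
rewrite -!powR_mulrn// -powRN -powRrM -powRD ?pnatr_eq0 ?implybT//.
rewrite -[leRHS](powRr0 2) ler_powR ?ler1n// mulNr subr_le0.
have := rN i; rewrite -(ler_nat R) natrM => /(ler_wpM2r (ltW eps0)).
apply: le_trans; rewrite mulrAC.
have -> : ((4 * k i).*2)%:R = 8 * (k i)%:R :> R by rewrite -natrM; congr (_%:R); lia.
by rewrite ler_wpM2r.
Qed.
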